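(* Let $1\le n<\infty$, and let $P=(p_{ij})_{1\le i,j\le n}$ be an irreducible, aperiodic transition matrix reversible with respect to a probability vector $\pi=(\pi_i)_{1\le i\le n}$. Let $\mathbf{Y}(t)$, $t\ge0$, be the smoothing process associated with $P$, started from any (possibly random) $\mathbf{Y}(0)\ge0$, with variance functional $\mathcal{V}(t)$ and functionals $\mathcal{E}^{(2)}(t)$, $\mathcal{E}^*(t)$ as defined in the context. Then $$\int_0^\infty\mathbb{E}\left(\mathcal{E}^{(2)}(t)+\mathcal{E}^*(t)\right)dt=\mathbb{E}\,\mathcal{V}(0).$$
   Context: Reversibility means $\pi_i p_{ij}=\pi_j p_{ji}$ for all $i,j$. Smoothing process: sites are $\{1,\dots,n\}$; each site carries a unit-intensity Poisson process (clock); all clocks are jointly independent and independent of $\mathbf{Y}(0)$. When the clock at site $k$ rings at time $t$, the value at $k$ is updated to $Y_k(t)=\sum_{j=1}^np_{kj}Y_j(t-)$, and the values at the other sites remain unchanged. Let $p^{(2)}_{jk}$ be the entries of $P^2$ and let $Q=(q_{ij})=P-I$. For $\mathbf{y}\in\mathbb{R}^n$ set $\overline{y}=\sum_i\pi_iy_i$ and $$\mathbf{V}(\mathbf{y})=\sum_{i=1}^n\pi_i(y_i-\overline{y})^2,\quad \mathbf{E}^{(2)}(\mathbf{y})=\frac12\sum_{j,k=1}^n\pi_jp^{(2)}_{jk}(y_j-y_k)^2,\quad \mathbf{E}^*(\mathbf{y})=\sum_{i=1}^n\Big(\pi_i\sum_{k=1}^nq_{ik}y_k\Big)^2,$$ and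 $\mathcal{V}(t)=\mathbf{V}(\mathbf{Y}(t))$, $\mathcal{E}^{(2)}(t)=\mathbf{E}^{(2)}(\mathbf{Y}(t))$, $\mathcal{E}^*(t)=\mathbf{E}^*(\mathbf{Y}(t))$. *)

(* Defs.v *)
From HB Require Import structures.
From mathcomp Require Import all_boot all_order all_algebra.
From mathcomp Require Import finmap.
From mathcomp Require Import all_classical all_reals all_analysis.

Set Implicit Arguments.
Unset Strict Implicit.
Unset Printing Implicit Defensive.

Import Order.TTheory GRing.Theory Num.Theory.
Import numFieldNormedType.Exports.

Local Open Scope classical_set_scope.
Local Open Scope ring_scope.

Section Chain.
Context {R : realType} {n : nat}.
Implicit Types (P : 'M[R]_n) (p y : 'I_n -> R).

Definition transition_matrix P : Prop :=
  (forall i j, 0 <= P i j) /\ (forall i, \sum_j P i j = 1).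

Definition probability_vector p : Prop :=
  (forall i, 0 <= p i) /\ \sum_i p i = 1.

Definition irreducible P : Prop :=
  forall i j, exists m : nat, 0 < (P ^+ m) i j.

(* The gcd of the set of return times of every state is 1: any common divisor
   of the return times is 1. *)
Definition aperiodic P : Prop :=
  forall i (g : nat),
    (forall m : nat, (0 < m)%N -> 0 < (P ^+ m) i i -> (g %| m)%N) -> g = 1%N.

Definition reversible P p : Prop :=
  forall i j, p i * P i j = p j * P j i.

Definition wmean p y : R := \sum_i p i * y i.

Definition variance_fun p y : R := \sum_i p i * (y i - wmean p y) ^+ 2.

Definition energy2 P p y : R :=
  2^-1 * \sum_j \sum_k p j * (P ^+ 2) j k * (y j - y k) ^+ 2.

Definition energy_star P p y : R :=
  let Q := P - 1%:M in \sum_i (p i * \sum_k Q i k * y k) ^+ 2.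

End Chain.

Section Independence.
Context {d : measure_display} {T : measurableType d} {R : realType}.
Variable Pr : probability T R.

(* sigma-algebra generated by a family (X i) of random elements, i ranging
   over the index set D *)
Definition sigma_of {d'} {U : measurableType d'} {I : Type}
    (D : set I) (X : I -> T -> U) : set (set T) :=
  <<s \bigcup_(i in D) preimage_set_system setT (X i) measurable >>.

Definition mutually_independent {I : choiceType} (F : I -> set (set T)) : Prop :=
  forall (J : {fset I}) (A : I -> set T),
    (forall i, i \in J -> F i (A i)) ->
    Pr (\bigcap_(i in [set` J]) A i) = (\prod_(i <- J) Pr (A i))%E.

End Independence.

Section Smoothing.
Context {d : measure_display} {T : measurableType d} {R : realType}.
Variable Pr : probability T R.

(* Time is indexed by R, but nothing is required at negative times. The
   truncated subtraction on nat is harmless: paths are a.s. nondecreasing. *)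
Definition unit_poisson_process (N : R -> {RV Pr >-> nat}) : Prop :=
  [/\ {ae Pr, forall w,
        [/\ N 0 w = 0%N,
            forall s t : R, 0 <= s <= t -> (N s w <= N t w)%N &
            forall t : R, 0 <= t -> N s w @[s --> t^'+] --> N t w]},
      forall (s t : R) (m : nat), 0 <= s < t ->
        Pr [set w | (N t w - N s w)%N = m] = (poisson_pmf (t - s) m)%:E &
      forall t : nat -> R, 0 <= t 0%N ->
        (forall i j : nat, (i <= j)%N -> t i <= t j) ->
        mutually_independent Pr (fun i : nat =>
          sigma_of [set: unit] (fun _ w => N (t i.+1) w - N (t i) w)%N)].

(* [f] is a path of a counting process; it rings at its jump times. *)
Definition rings (f : R -> nat) (t : R) : Prop :=
  0 < t /\ forall s, 0 <= s < t -> (f s < f t)%N.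

Context {n : nat}.

(* In the last clause Y_j(t-) is the left limit of the path of Y_j at t. *)
Definition smoothing_path (P : 'M[R]_n)
    (f : 'I_n -> R -> nat) (y : R -> 'I_n -> R) : Prop :=
  (forall k (s t : R), 0 <= s <= t ->
     (forall u, s < u <= t -> ~ rings (f k) u) -> y t k = y s k) /\
  (forall k (t : R), rings (f k) t ->
     y t k = \sum_j P k j * lim (y s j @[s --> t^'-])).

(* In the second clause, [None] stands for the initial state Y(0) and [Some k]
   for the clock at site k. *)
Definition smoothing_process (P : 'M[R]_n)
    (N : 'I_n -> R -> {RV Pr >-> nat}) (Y : R -> 'I_n -> {RV Pr >-> R}) : Prop :=
  [/\ forall k, unit_poisson_process (N k),
      mutually_independent Pr (fun o : option 'I_n =>
        if o is Some k then sigma_of [set t : R | 0 <= t] (N k)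
        else sigma_of [set: 'I_n] (Y 0)) &
      {ae Pr, forall w, smoothing_path P (fun k t => N k t w)
                                         (fun t k => Y t k w)}].

End Smoothing.

(* Main.v *)
Require Import Defs.
From HB Require Import structures.
From mathcomp Require Import all_boot all_order all_algebra.
From mathcomp Require Import finmap.
From mathcomp Require Import all_classical all_reals all_analysis.
From mathcomp Require Import measurable_realfun ring lra.

Set Implicit Arguments.
Unset Strict Implicit.
Unset Printing Implicit Defensive.

Import Order.TTheory GRing.Theory Num.Theory.
Import numFieldNormedType.Exports.

Local Open Scope classical_set_scope.
Local Open Scope ring_scope.

(** The idea is that t |-> E V(t) is differentiable with derivative
    - E (E2 + Estar)(t) and tends to 0 at infinity, so that integrating the
    derivative over [0, +oo[ gives E V(0).

    Algebra.  Let U_k denote the update at site k.  Expanding the squares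
    and using stationarity and reversibility, the drift of the variance under
    clocks of rate 1 is
    sum_k (V (U_k y) - V y) = - (E2 y + Estar y) (generator_variance).  Irreducibility
    and aperiodicity of P make P^2 irreducible (irreducible_square), and a path
    argument then bounds V by a constant multiple of E2 (poincare).

    Probability.  Cut a time interval along a grid and record in each cell either no ring at
    all (None) or exactly one ring, at site k (Some k).  The resulting word
    determines the state at the end of the grid from the initial state
    (state_history), and independence of the increments of the clocks, of the
    clocks, and of the initial state gives each word a product weight,
    independently of the initial state (prob_history).  The histories that no
    word describes, with several rings in one cell, have probability at most
    n^2 times the sum of the squares of the cell lengths
    (word_mass_ge).  Refining the grid on [0, t] while keeping one last cell of
    length e yields the one-step Markov estimate truncated_mean_step: the mean
    of f (Y (t + e)) is the weighted sum of the means of f (U_o (Y t)) up to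
    O(e^2).  For f = V this is the differential equation above, with an error
    uniform in t (variance_step); for f = E2 + Estar it gives Lipschitz continuity
    (dissipation_step).

    Since E V(0) may be infinite, these estimates are made for the process
    restricted to the event that the initial state and the current state lie in
    the box [-M, M]^n; updates are convex combinations, so every path that is
    described by a word stays in the box it starts from.  The differential
    equation and the spectral gap give the identity at each level M
    (integral_truncated_dissipation), and monotone convergence as M grows gives
    the theorem, including the case where both sides are infinite. *)

(** * Dirichlet forms and the drift of the variance *)

Section Dirichlet.
Context {R : realType} {n : nat}.
Implicit Types (P A B : 'M[R]_n) (p y : 'I_n -> R).

Definition dirichlet p A y : R :=
  2^-1 * \sum_j \sum_k p j * A j k * (y j - y k) ^+ 2.

Definition stationary p A : Prop := forall k, \sum_j p j * A j k = p k.

Lemma reversible_stationary P p :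
  transition_matrix P -> reversible P p -> stationary p P.
Proof.
move=> [_ P1] rev k; under eq_bigr do rewrite rev.
by rewrite -mulr_sumr P1 mulr1.
Qed.

Lemma transition_matrix1 : transition_matrix (1 : 'M[R]_n).
Proof.
split=> [i j|i]; first by rewrite mxE; case: eqP.
rewrite (bigD1 i)//= mxE eqxx big1 ?addr0// => j ji.
by rewrite mxE eq_sym (negbTE ji).
Qed.

Lemma stationary1 p : stationary p (1 : 'M[R]_n).
Proof.
move=> k; rewrite (bigD1 k)//= mxE eqxx mulr1 big1 ?addr0// => j jk.
by rewrite mxE (negbTE jk) mulr0.
Qed.

Lemma mxmulE A B i j : (A * B) i j = \sum_k A i k * B k j.
Proof. by rewrite mxE. Qed.

Lemma transition_matrixM A B :
  transition_matrix A -> transition_matrix B -> transition_matrix (A * B).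
Proof.
move=> [A0 A1] [B0 B1]; split=> [i j|i].
  by rewrite mxmulE sumr_ge0// => k _; rewrite mulr_ge0.
under eq_bigr do rewrite mxmulE.
rewrite exchange_big/= -[RHS](A1 i); apply: eq_bigr => k _.
by rewrite -mulr_sumr B1 mulr1.
Qed.

Lemma stationaryM p A B :
  stationary p A -> stationary p B -> stationary p (A * B).
Proof.
move=> sA sB k.
under eq_bigr do rewrite mxmulE mulr_sumr.
rewrite exchange_big/= -[RHS]sB; apply: eq_bigr => i _.
by rewrite -(sA i) mulr_suml; apply: eq_bigr => j _; rewrite mulrA.
Qed.

Lemma transition_matrixX A m : transition_matrix A -> transition_matrix (A ^+ m).
Proof.
move=> tA; elim: m => [|m IH]; first by rewrite expr0; exact: transition_matrix1.
by rewrite exprS; exact: transition_matrixM.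
Qed.

Lemma stationaryX p A m : stationary p A -> stationary p (A ^+ m).
Proof.
move=> sA; elim: m => [|m IH]; first by rewrite expr0; exact: stationary1.
by rewrite exprS; exact: stationaryM.
Qed.

Lemma dirichlet_ge0 p A y :
  (forall i, 0 <= p i) -> transition_matrix A -> 0 <= dirichlet p A y.
Proof.
move=> p0 [A0 _]; rewrite mulr_ge0 ?invr_ge0// sumr_ge0// => j _.
by rewrite sumr_ge0// => k _; rewrite mulr_ge0 ?sqr_ge0 ?mulr_ge0.
Qed.

(** Follow a two-step stationary path j, i, k, with steps drawn from A and
    B, and use (y j - y k)^2 <= 2 (y j - y i)^2 + 2 (y i - y k)^2; summing out
    the free endpoint leaves the forms of A and of B. *)
Lemma dirichletM p A B y :
  (forall i, 0 <= p i) -> transition_matrix A -> transition_matrix B ->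
  stationary p A ->
  dirichlet p (A * B) y <= 2 * dirichlet p A y + 2 * dirichlet p B y.
Proof.
move=> p0 [A0 A1] [B0 B1] sA.
suff H : \sum_j \sum_k p j * (A * B) j k * (y j - y k) ^+ 2 <=
   2 * \sum_j \sum_k p j * A j k * (y j - y k) ^+ 2 +
   2 * \sum_j \sum_k p j * B j k * (y j - y k) ^+ 2.
  by rewrite /dirichlet; lra.
have -> : \sum_j \sum_k p j * A j k * (y j - y k) ^+ 2 =
   \sum_j \sum_k \sum_i p j * A j i * B i k * (y j - y i) ^+ 2.
  apply: eq_bigr => j _; rewrite [RHS]exchange_big/=; apply: eq_bigr => i _.
  by rewrite -mulr_suml -mulr_sumr B1 mulr1.
have -> : \sum_j \sum_k p j * B j k * (y j - y k) ^+ 2 =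
   \sum_j \sum_k \sum_i p j * A j i * B i k * (y i - y k) ^+ 2.
  rewrite [RHS]exchange_big/= [LHS]exchange_big/=; apply: eq_bigr => k _.
  rewrite [RHS]exchange_big/=; apply: eq_bigr => i _.
  by rewrite -!mulr_suml sA.
rewrite !mulr_sumr -big_split/=; apply: ler_sum => j _.
rewrite !mulr_sumr -big_split/=; apply: ler_sum => k _.
rewrite !mulr_sumr -big_split/= mxmulE mulr_sumr mulr_suml; apply: ler_sum => i _.
have h : 0 <= p j * A j i * B i k by rewrite !mulr_ge0.
set c := p j * A j i * B i k in h *.
have -> : p j * (A j i * B i k) = c by rewrite mulrA.
(* 2 (a^2 + b^2) - (a + b)^2 = (a - b)^2 with a = y j - y i, b = y i - y k *)
have := mulr_ge0 h (sqr_ge0 (y j - 2 * y i + y k)).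
lra.
Qed.

Lemma dirichletX p A m :
  (forall i, 0 <= p i) -> transition_matrix A -> stationary p A ->
  exists2 K, 0 <= K & forall y, dirichlet p (A ^+ m) y <= K * dirichlet p A y.
Proof.
move=> p0 tA sA; elim: m => [|m [K K0 IH]].
  exists 0 => // y; rewrite mul0r expr0 /dirichlet big1 ?mulr0// => j _.
  rewrite big1// => k _; rewrite mxE; case: eqP => [->|_].
    by rewrite subrr expr0n/= mulr0.
  by rewrite mulr0 mul0r.
exists (2 + 2 * K) => [|y]; first by lra.
rewrite exprS; have := dirichletM y p0 tA (transition_matrixX m tA) sA.
have := IH y; lra.
Qed.

Lemma variance_pairs p y : probability_vector p ->
  variance_fun p y = 2^-1 * \sum_i \sum_j p i * p j * (y i - y j) ^+ 2.
Proof.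
move=> [_ p1].
have -> : \sum_i \sum_j p i * p j * (y i - y j) ^+ 2 =
  \sum_i (p i * y i ^+ 2 - 2 * wmean p y * (p i * y i)
          + p i * \sum_j p j * y j ^+ 2).
  apply: eq_bigr => i _.
  have -> : p i * y i ^+ 2 = \sum_j p i * y i ^+ 2 * p j.
    by rewrite -mulr_sumr p1 mulr1.
  rewrite /wmean mulr_sumr mulr_suml mulr_sumr -sumrB -big_split/=.
  by apply: eq_bigr => j _; ring.
rewrite big_split/= sumrB -!mulr_suml p1 mul1r -mulr_sumr.
rewrite -/(wmean p y) /variance_fun.
have -> : \sum_i p i * (y i - wmean p y) ^+ 2 =
  \sum_i (p i * y i ^+ 2 - 2 * wmean p y * (p i * y i) + p i * wmean p y ^+ 2).
  by apply: eq_bigr => i _; ring.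
rewrite big_split/= sumrB -!mulr_suml p1 mul1r -mulr_sumr -/(wmean p y).
by field.
Qed.

Lemma variance_sqr p y : probability_vector p ->
  variance_fun p y = \sum_i p i * y i ^+ 2 - wmean p y ^+ 2.
Proof.
move=> [_ p1]; rewrite /variance_fun.
have -> : \sum_i p i * (y i - wmean p y) ^+ 2 =
  \sum_i (p i * y i ^+ 2 - 2 * wmean p y * (p i * y i) + p i * wmean p y ^+ 2).
  by apply: eq_bigr => i _; ring.
rewrite big_split/= sumrB -!mulr_suml p1 mul1r -mulr_sumr -/(wmean p y).
by ring.
Qed.

(** A path from i to j of odd length is made even by a return path to i
    of odd length; such a return exists, for otherwise 2 would be a period. *)
Lemma irreducible_square P : transition_matrix P ->
  irreducible P -> aperiodic P -> irreducible (P ^+ 2).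
Proof.
move=> tP irr aper i j; have [m Pm] := irr i j.
have [om|em] := boolP (odd m); last first.
  by exists m./2; rewrite -exprM mul2n even_halfK.
have [r [or Pr]] : exists r, odd r /\ 0 < (P ^+ r) i i.
  apply: contrapT => h; suff : 2%N = 1%N by [].
  apply: (aper i) => r r0 Pr; rewrite dvdn2; apply/negP => or.
  by apply: h; exists r.
exists (r + m)./2; rewrite -exprM mul2n even_halfK ?oddD ?or ?om//.
rewrite exprD mxmulE (bigD1 i)//= ltr_wpDr ?mulr_gt0// sumr_ge0// => k _.
by rewrite mulr_ge0//; apply: (transition_matrixX _ tP).1.
Qed.

(** Each pair i, j is joined by some power of P, whose Dirichlet form
    dominates (y i - y j)^2 up to the weight p i and is itself dominated by the
    form of P.  The variance only sees the pairs through p i * p j, so states of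
    weight 0 cause no loss. *)
Lemma poincare P p : transition_matrix P -> probability_vector p ->
  stationary p P -> irreducible P ->
  exists2 K, 0 < K & forall y, variance_fun p y <= K * dirichlet p P y.
Proof.
move=> tP pp sP irr; have p0 := pp.1.
have pair i j : exists K, 0 <= K /\
    forall y, p i * p j * (y i - y j) ^+ 2 <= K * dirichlet p P y.
  have [m Pm] := irr i j; have [K K0 HK] := dirichletX m p0 tP sP.
  have tPm := transition_matrixX m tP.
  exists (p j / (P ^+ m) i j * 2 * K); split.
    by rewrite !mulr_ge0// invr_ge0 ltW.
  move=> y; have : p i * (P ^+ m) i j * (y i - y j) ^+ 2 <= 2 * dirichlet p (P ^+ m) y.
    rewrite /dirichlet [leRHS]mulrA divff// mul1r (bigD1 i)//= (bigD1 j)//= -addrA lerDl.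
    rewrite addr_ge0// sumr_ge0// => k _; last rewrite sumr_ge0// => l _.
      by rewrite mulr_ge0 ?sqr_ge0 ?mulr_ge0//; apply: tPm.1.
    by rewrite mulr_ge0 ?sqr_ge0 ?mulr_ge0//; apply: tPm.1.
  move=> h; have {}h := le_trans h (ler_wpM2l _ (HK y)).
  have c0 : 0 <= p j / (P ^+ m) i j by rewrite mulr_ge0// invr_ge0 ltW.
  have := ler_wpM2l c0 (h (ler0n _ _)).
  have -> : p j / (P ^+ m) i j * (p i * (P ^+ m) i j * (y i - y j) ^+ 2) =
    p i * p j * (y i - y j) ^+ 2 by field; rewrite gt_eqF.
  by rewrite !mulrA.
have /choice [K HK] : forall ij : 'I_n * 'I_n, exists K, 0 <= K /\
    forall y, p ij.1 * p ij.2 * (y ij.1 - y ij.2) ^+ 2 <= K * dirichlet p P y.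
  by move=> [i j]; exact: pair.
exists (1 + \sum_i \sum_j K (i, j)).
  rewrite ltr_wpDr// sumr_ge0// => i _; rewrite sumr_ge0// => j _.
  by case: (HK (i, j)).
move=> y; rewrite variance_pairs//.
have D0 := dirichlet_ge0 y p0 tP.
set S := \sum_i \sum_j K (i, j).
have S0 : 0 <= S * dirichlet p P y.
  rewrite mulr_ge0// sumr_ge0// => i _; rewrite sumr_ge0// => j _.
  by case: (HK (i, j)).
have : \sum_i \sum_j p i * p j * (y i - y j) ^+ 2 <= S * dirichlet p P y.
  rewrite /S mulr_suml ler_sum// => i _; rewrite mulr_suml ler_sum// => j _.
  by case: (HK (i, j)) => _; apply.
lra.
Qed.

(** The index None stands for a time cell in which no clock rings. *)
Definition update P (o : option 'I_n) y : 'I_n -> R :=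
  if o is Some k then fun i => if i == k then \sum_j P k j * y j else y i else y.

Definition dissipation P p y : R := energy2 P p y + energy_star P p y.

(** With q k the increment at site k, updating k changes sum_i p_i y_i^2 by
    p k ((P y)_k^2 - y_k^2) and the mean by p k * q k.  The increments of the
    mean sum to 0 by stationarity, their squares sum to Estar, and reversibility
    turns sum_k p k (P y)_k^2 into the quadratic form of P^2, which leaves
    - E2. *)
Lemma generator_variance P p y :
  transition_matrix P -> probability_vector p -> reversible P p ->
  \sum_k variance_fun p (update P (Some k) y) =
  n%:R * variance_fun p y - dissipation P p y.
Proof.
move=> tP pp rev; have sP := reversible_stationary tP rev.
(* increment of the value at k when its clock rings *)
pose q k := \sum_i (P - 1%:M) k i * y i.
have qE k : q k = \sum_j P k j * y j - y k.
  rewrite /q; under eq_bigr do rewrite !mxE mulrBl.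
  rewrite sumrB; congr (_ - _).
  rewrite (bigD1 k)//= eqxx mul1r big1 ?addr0// => j jk.
  by rewrite eq_sym (negbTE jk) mul0r.
have upd (F : 'I_n -> R -> R) k : \sum_i F i (update P (Some k) y i) =
    \sum_i F i (y i) + (F k (y k + q k) - F k (y k)).
  rewrite (bigD1 k)//= eqxx [X in _ = X + _](bigD1 k)//= qE.
  have -> : \sum_(i | i != k) F i (if i == k then \sum_j P k j * y j else y i) =
      \sum_(i | i != k) F i (y i).
    by apply: eq_bigr => i /negbTE ->.
  by rewrite [y k + _]addrC subrK; ring.
have Vk k : variance_fun p (update P (Some k) y) = variance_fun p y +
    (p k * ((\sum_j P k j * y j) ^+ 2 - y k ^+ 2) - 2 * wmean p y * (p k * q k)
     - (p k * q k) ^+ 2).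
  rewrite !variance_sqr// (upd (fun i x => p i * x ^+ 2)) /=.
  rewrite /wmean (upd (fun i x => p i * x)) /= qE; ring.
under eq_bigr do rewrite Vk.
rewrite big_split/= sumr_const card_ord -[X in X + _]mulr_natl; congr (_ + _).
rewrite !sumrB -mulr_sumr.
have -> : \sum_i p i * q i = 0.
  under eq_bigr do rewrite qE mulrBr mulr_sumr.
  rewrite sumrB exchange_big/=; apply/eqP; rewrite subr_eq0; apply/eqP.
  apply: eq_bigr => j _; under eq_bigr do rewrite mulrA.
  by rewrite -mulr_suml sP.
rewrite mulr0 subr0 /dissipation opprD; congr (_ - _).
have -> : energy2 P p y = dirichlet p (P ^+ 2) y by [].
rewrite /dirichlet.
have t2 := transition_matrixX 2 tP; have s2 := stationaryX 2 sP.
have -> : \sum_j \sum_k p j * (P ^+ 2) j k * (y j - y k) ^+ 2 =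
  \sum_j \sum_k p j * (P ^+ 2) j k * y j ^+ 2
  + \sum_j \sum_k p j * (P ^+ 2) j k * y k ^+ 2
  - 2 * \sum_j \sum_k p j * (P ^+ 2) j k * y j * y k.
  rewrite mulr_sumr -sumrN -!big_split/=; apply: eq_bigr => j _.
  rewrite mulr_sumr -sumrN -!big_split/=; apply: eq_bigr => k _; ring.
have -> : \sum_j \sum_k p j * (P ^+ 2) j k * y j ^+ 2 = \sum_j p j * y j ^+ 2.
  apply: eq_bigr => j _; rewrite -mulr_suml -mulr_sumr.
  by rewrite t2.2 mulr1.
have -> : \sum_j \sum_k p j * (P ^+ 2) j k * y k ^+ 2 = \sum_j p j * y j ^+ 2.
  rewrite exchange_big/=; apply: eq_bigr => k _.
  by rewrite -mulr_suml s2.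
have -> : \sum_j \sum_k p j * (P ^+ 2) j k * y j * y k =
    \sum_i p i * (\sum_j P i j * y j) ^+ 2.
  transitivity (\sum_j \sum_k \sum_i p i * (P i j * y j) * (P i k * y k)).
    apply: eq_bigr => j _; apply: eq_bigr => k _.
    rewrite expr2 mxmulE mulr_sumr !mulr_suml; apply: eq_bigr => i _.
    by rewrite mulrA rev; ring.
  rewrite exchange_big/=.
  rewrite [LHS](eq_bigr (fun k =>
    \sum_i (p i * (\sum_j P i j * y j)) * (P i k * y k))); last first.
    move=> k _; rewrite exchange_big/=; apply: eq_bigr => i _.
    by rewrite -mulr_suml -mulr_sumr.
  rewrite exchange_big/=; apply: eq_bigr => i _.
  by rewrite -mulr_sumr expr2 mulrA.
under eq_bigr do rewrite mulrBr.
by rewrite sumrB; field.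
Qed.

End Dirichlet.

(** * Paths of the smoothing process between two times *)

Section Paths.
Context {R : realType}.
Implicit Types (f : R -> nat) (a b s t u : R).

Definition counting_path f : Prop :=
  (forall s t, 0 <= s <= t -> (f s <= f t)%N) /\
  (forall t, 0 <= t -> f s @[s --> t^'+] --> f t).

Lemma counting_path_right f t : counting_path f -> 0 <= t ->
  exists2 e, 0 < e & forall s, t <= s < t + e -> f s = f t.
Proof.
move=> [_ rc] t0; have /discrete_cvg := rc t t0.
rewrite /at_right /within/= /nbhs/= => -[e /= e0 H]; exists e => // s.
move=> /andP[]; rewrite le_eqVlt => /orP[/eqP <-//|ts ste].
by apply: H => //=; rewrite ltr0_norm; lra.
Qed.

Lemma rings_lt f u s : rings f u -> 0 <= s < u -> (f s < f u)%N.
Proof. by move=> [_]; apply. Qed.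

Lemma constant_no_rings f a b : counting_path f -> 0 <= a -> f a = f b ->
  forall u, a < u <= b -> ~ rings f u.
Proof.
move=> [mono _] a0 ab u /andP[au ub] ru.
have := rings_lt ru (_ : 0 <= a < u); rewrite a0 au => /(_ isT).
by rewrite ab ltnNge mono// ub andbT; lra.
Qed.

(** The ring is at the infimum of the times in [a, b] at which f exceeds
    f a; right continuity makes that infimum larger than a and attained. *)
Lemma single_ring f a b : counting_path f -> 0 <= a <= b -> f b = (f a).+1 ->
  exists u, [/\ a < u <= b, rings f u, forall s, a <= s < u -> f s = f a &
    f u = f b].
Proof.
move=> cf /andP[a0 ab] fab; have [mono _] := cf.
pose S := [set s | a <= s <= b /\ (f a < f s)%N].
have Sb : S b by split; rewrite ?ab ?lexx// fab.
have lbS : lbound S a by move=> s [/andP[]].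
have infS : has_inf S by split; [exists b | exists a].
pose u := inf S.
have ub : u <= b by apply: ge_inf => //; exists a.
have au : a < u.
  have [e e0 He] := counting_path_right cf a0.
  apply: (@lt_le_trans _ _ (a + e)); first by rewrite ltrDl.
  apply: lb_le_inf; first by exists b.
  move=> s [/andP[as_ sb]]; rewrite leNgt => fas; apply/negP => sae.
  by rewrite He ?ltnn// in fas; rewrite as_ sae.
have u0 : 0 <= u by lra.
(* right continuity at u: f u is the value of f at points of S close to u *)
have fau : (f a < f u)%N.
  have [e e0 He] := counting_path_right cf u0.
  have [s Ss sue] := inf_adherent e0 infS.
  have us : u <= s by apply: ge_inf => //; exists a.
  by rewrite -(He s) ?us//; case: Ss.
have below s : a <= s < u -> f s = f a.
  move=> /andP[as_ su]; apply/eqP; rewrite eqn_leq [X in _ && X]mono ?a0// andbT.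
  rewrite leqNgt; apply/negP => fas.
  have : u <= s by apply: ge_inf; [exists a | split => //; lra].
  by rewrite leNgt su.
exists u; split => //; first by rewrite au.
- split; first by lra.
  move=> s /andP[s0 su]; have [sa|as_] := ltP s a.
    by rewrite (leq_ltn_trans _ fau)// mono// s0 ltW.
  by rewrite below// as_.
- by apply/eqP; rewrite eqn_leq mono ?u0// fab.
Qed.

Context {n : nat}.
Variables (P : 'M[R]_n) (f : 'I_n -> R -> nat) (y : R -> 'I_n -> R).
Hypotheses (cf : forall k, counting_path (f k)) (sy : smoothing_path P f y).

Lemma smoothing_path_constant k a b : 0 <= a <= b -> f k a = f k b ->
  y b k = y a k.
Proof.
move=> /andP[a0 ab] fab; apply: sy.1; first by rewrite a0.
exact: constant_no_rings.
Qed.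

(** Just before its only ring u, the clock k has not rung since a, nor has
    any other clock, so the left limits that enter the update at u are the
    values at a. *)
Lemma smoothing_path_update a b (o : option 'I_n) : 0 <= a < b ->
  (forall k, (f k b - f k a)%N = (o == Some k)) -> y b = update P o (y a).
Proof.
move=> /andP[a0 ab] incr.
have mono k : (f k a <= f k b)%N by apply: (cf k).1; rewrite a0 ltW.
have fE k : f k b = ((o == Some k) + f k a)%N by rewrite -incr subnK.
have other k : o != Some k -> y b k = y a k.
  move=> /negbTE ok; apply: smoothing_path_constant; first by rewrite a0 ltW.
  by rewrite fE ok.
case: o => [k|] in incr fE other *; last by apply/funext => i; exact: other.
apply/funext => i /=; case: eqP => [->{i}|/eqP ik]; last first.
  by apply: other; apply: contra ik => /eqP[->].
have ab0 : 0 <= a <= b by rewrite a0 ltW.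
have fk1 : f k b = (f k a).+1 by rewrite fE eqxx.
have [u [/andP[au ub] ru below fu]] := single_ring (cf k) ab0 fk1.
have -> : y b k = y u k.
  by apply: smoothing_path_constant => //; rewrite ub andbT; lra.
rewrite sy.2//; apply: eq_bigr => j _; congr (_ * _).
apply: norm_lim_near_cst; near=> s.
have as_ : a <= s by near: s; apply: nbhs_left_ge.
have su : s < u by near: s; apply: nbhs_left_lt.
apply: smoothing_path_constant; first by rewrite a0.
have [->|jk] := eqVneq j k; first by rewrite below// as_.
have fjab : f j b = f j a.
  by rewrite fE; case: eqP => // -[kj]; rewrite kj eqxx in jk.
apply/eqP; rewrite eqn_leq; apply/andP; split; first by apply: (cf j).1; rewrite a0.
by rewrite -fjab; apply: (cf j).1; lra.
Unshelve. all: by end_near. Qed.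

End Paths.

(** * Integrating the dissipation rate *)

Section Dissipation.
Context {R : realType}.
Variables (phi g : R -> R) (K c : R).
Hypotheses (c0 : 0 < c) (K0 : 0 <= K).
Hypotheses (phi_ge0 : forall t, 0 <= t -> 0 <= phi t)
  (gap : forall t, 0 <= t -> c * phi t <= g t).
Hypothesis phi_step : forall t e, 0 <= t -> 0 < e <= 1 ->
  `|phi (t + e) - phi t + e * g t| <= K * e ^+ 2.
Hypothesis g_step : forall t e, 0 <= t -> 0 < e <= 1 ->
  `|g (t + e) - g t| <= K * e.

Let g_ge0 t : 0 <= t -> 0 <= g t.
Proof. by move=> t0; rewrite (le_trans _ (gap t0))// mulr_ge0// ?phi_ge0// ltW. Qed.

Let addBK (a b : R) : a + (b - a) = b. Proof. by ring. Qed.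

Let K1 : 0 < 2 * K + 1. Proof. by move: K0 => H; lra. Qed.

Let small e : 0 < e -> 0 < Num.min 1 (e / (2 * K + 1)).
Proof. by move=> e0; rewrite lt_min ltr01 divr_gt0. Qed.

Let smallP e h : 0 < e -> 0 <= h <= Num.min 1 (e / (2 * K + 1)) ->
  h <= 1 /\ 2 * K * h <= e.
Proof.
move=> e0 /andP[h0]; rewrite le_min => /andP[h1]; rewrite ler_pdivlMr// => h2.
by split => //; rewrite (le_trans _ h2)//; lra.
Qed.

Let step_right (F : R -> R) (B : R) t :
  (forall e, 0 < e <= 1 -> `|F (t + e) - F t| <= B * e) ->
  F x @[x --> t^'+] --> F t.
Proof.
move=> H; apply/cvgrPdist_le => e e0.
have B1 : 0 < 1 + `|B| by rewrite ltr_pwDl.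
near=> x.
have tx : t < x by near: x; exact: nbhs_right_gt.
have xt : x - t <= Num.min 1 (e / (1 + `|B|)).
  rewrite lerBlDl; near: x; apply: nbhs_right_le.
  by rewrite ltrDl lt_min ltr01 divr_gt0.
move: xt; rewrite le_min => /andP[x1]; rewrite ler_pdivlMr// => x2.
have := H (x - t); rewrite subr_gt0 tx x1 => /(_ isT).
rewrite addBK distrC => /le_trans; apply.
apply: le_trans x2; rewrite mulrC ler_wpM2l//; first lra.
by rewrite (le_trans (ler_norm B))// lerDr.
Unshelve. all: by end_near. Qed.

(** For h < 0 the step estimate is used at the earlier time t + h, and the
    Lipschitz bound on g replaces g (t + h) by g t. *)
Lemma cvg_step_quotient (t : R) : 0 < t ->
  (fun h : R => h^-1 *: ((phi \o shift t) (h *: (1 : R)) - phi t)) @ (0 : R)^' -->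
    - g t.
Proof.
move=> t0; apply/cvgrPdist_le => e e0; near=> h.
have hn0 : h != 0 by near: h; exact: nbhs_dnbhs_neq.
have hd : `|h| <= Num.min t (Num.min 1 (e / (2 * K + 1))).
  near: h; apply: dnbhs0_le.
  by rewrite lt_min t0 small.
move: hd; rewrite le_min => /andP[ht hd].
have [h1 hKe] : `|h| <= 1 /\ 2 * K * `|h| <= e by apply: smallP => //; rewrite normr_ge0.
rewrite /= [h *: 1]mulr1 [_ *: _]mulrC.
suff : `|phi (h + t) - phi t + h * g t| <= 2 * K * `|h| ^+ 2.
  move=> H; rewrite (_ : - g t - _ = - (phi (h + t) - phi t + h * g t) / h); last by field.
  rewrite normrM normrN normfV ler_pdivrMr ?normr_gt0// (le_trans H)//.
  by rewrite expr2 mulrA ler_wpM2r.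
have [hp|hneg] := ltP 0 h.
  rewrite (gtr0_norm hp) in h1 *.
  have h01 : 0 < h <= 1 by rewrite hp.
  have := phi_step (ltW t0) h01; rewrite [t + h]addrC => /le_trans; apply.
  by have := mulr_ge0 K0 (sqr_ge0 h); lra.
have {}hneg : h < 0 by rewrite lt_neqAle hn0.
rewrite (ltr0_norm hneg) in ht h1 *.
have s0 : 0 <= t + h by lra.
have d1 : 0 < - h <= 1 by lra.
have := phi_step s0 d1; have := g_step s0 d1; rewrite addrK => A1 A2.
have A3 : `|- h * (g t - g (t + h))| <= K * (- h) ^+ 2.
  rewrite normrM gtr0_norm; last lra.
  by rewrite expr2 mulrCA ler_wpM2l; lra.
have -> : phi (h + t) - phi t + h * g t =
  - (phi t - phi (t + h) + - h * g (t + h)) - (- h * (g t - g (t + h))).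
  by rewrite [t + h]addrC; ring.
by rewrite (le_trans (ler_normB _ _))// normrN; lra.
Unshelve. all: by end_near. Qed.

Lemma is_derive_step (t : R) : 0 < t -> is_derive t 1 phi (- g t).
Proof.
move=> t0; have H := cvg_step_quotient t0.
split; first by apply/cvg_ex; exists (- g t); exact: H.
by apply: cvg_lim => //; exact: H.
Qed.

Lemma cvg_right_step : phi x @[x --> 0^'+] --> phi 0.
Proof.
apply: (@step_right _ (K + g 0)) => e /[dup] e1 /andP[e0 ele].
have := phi_step (lexx 0) e1; have := g_ge0 (lexx 0) => g0 H.
have -> : phi (0 + e) - phi 0 = (phi (0 + e) - phi 0 + e * g 0) - e * g 0 by ring.
rewrite (le_trans (ler_normB _ _))// [ `|e * _| ]ger0_norm ?mulr_ge0//; last lra.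
have : K * e ^+ 2 <= K * e by rewrite expr2 ler_wpM2l// ger_pMr.
by lra.
Qed.

Lemma continuous_step_rate : {within `[0, +oo[, continuous g}.
Proof.
apply/continuous_within_itvcyP; split; last first.
  by apply: (@step_right _ K) => e e1; exact: g_step.
move=> t; rewrite in_itv/= andbT => t0; apply/cvgrPdist_le => e e0.
have /cvgrPdist_le idt : (x : R) @[x --> t] --> t by exact: cvg_id.
near=> h.
have [->|/eqP hnt] := eqVneq h t; first by rewrite subrr normr0 ltW.
have hd : `|h - t| <= Num.min t (Num.min 1 (e / (2 * K + 1))).
  rewrite distrC; near: h; apply: idt.
  by rewrite lt_min t0 small.
move: hd; rewrite le_min => /andP[ht hd].
have [h1 hKe] : `|h - t| <= 1 /\ 2 * K * `|h - t| <= e.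
  by apply: smallP => //; rewrite normr_ge0.
have KK : K * `|h - t| <= e.
  by apply: le_trans hKe; have := mulr_ge0 K0 (normr_ge0 (h - t)); lra.
apply: le_trans KK; have [th|hlt] := ltP t h.
  have ht0 : 0 < h - t by rewrite subr_gt0.
  rewrite (gtr0_norm ht0) in h1 *.
  have ht1 : 0 < h - t <= 1 by rewrite ht0.
  by have := g_step (ltW t0) ht1; rewrite addBK distrC.
have {}hlt : h < t by rewrite lt_neqAle hlt andbT; exact/eqP.
have th0 : 0 < t - h by rewrite subr_gt0.
rewrite [X in _ <= _ * X]distrC; rewrite distrC in ht h1.
rewrite (gtr0_norm th0) in ht h1 *.
have h0 : 0 <= h by lra.
have th1 : 0 < t - h <= 1 by rewrite th0.
by have := g_step h0 th1; rewrite addBK.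
Unshelve. all: by end_near. Qed.

Lemma continuous_step : {within `[0, +oo[, continuous phi}.
Proof.
apply/continuous_within_itvcyP; split; last exact: cvg_right_step.
move=> t; rewrite in_itv/= andbT => t0.
apply: differentiable_continuous; apply/derivable1_diffP.
by have [] := is_derive_step t0.
Qed.

(** The function phi t * (1 + c t) is nonincreasing: its derivative is
    c phi - g (1 + c t), which is at most - c t g since c phi <= g.  Decay of order 1 / t
    is all that the integral needs. *)
Lemma gap_decay (t : R) : 0 <= t -> phi t * (1 + c * t) <= phi 0.
Proof.
move=> t0; pose psi x := phi x * (1 + c * x).
have der (x : R) : 0 < x -> is_derive x 1 psi (phi x * c + (1 + c * x) * - g x).
  move=> x0; have ? := is_derive_step x0.
  have D1 := is_deriveD (is_derive_cst (1 : R) x (1 : R))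
    (is_deriveZ c (is_derive_id x (1 : R))).
  have := is_deriveM (is_derive_step x0) D1.
  by rewrite add0r [c *: 1]mulr1.
have -> : phi 0 = psi 0 by rewrite /psi mulr0 addr0 mulr1.
apply: (@ler0_derive1_nincry _ psi 0) => //.
- by move=> x; rewrite in_itv/= andbT => x0; have [] := der x x0.
- move=> x; rewrite in_itv/= andbT => x0; rewrite derive1E.
  have [_ ->] := der x x0.
  have := gap (ltW x0); have := g_ge0 (ltW x0).
  have : 0 <= c * x by rewrite mulr_ge0// ltW.
  by move=> A1 A2 A3; have := mulr_ge0 A1 A2; lra.
- move=> x; apply: cvgM; first exact: continuous_step.
  apply: cvgD; first exact: cvg_cst.
  apply: cvgM; first exact: cvg_cst.
  by apply: continuous_subspaceT => z; exact: cvg_id.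
Qed.

Lemma integral_step_rate :
  (\int[lebesgue_measure]_(t in `[0%R, +oo[) (g t)%:E = (phi 0)%:E)%E.
Proof.
rewrite (@ge0_continuous_FTC2y _ g (fun t => - phi t) 0 0).
- by rewrite -EFinN opprK add0e.
- exact: g_ge0.
- exact: continuous_step_rate.
- rewrite -oppr0; apply: cvgN; apply/cvgrPdist_le => e e0; near=> t.
  have t0 : 0 <= t by near: t; exact: nbhs_pinfty_ge.
  have tl : phi 0 / (c * e) <= t by near: t; apply: nbhs_pinfty_ge; rewrite num_real.
  rewrite sub0r normrN ger0_norm ?phi_ge0//.
  have ct1 : 0 < 1 + c * t by rewrite ltr_pwDl// mulr_ge0// ltW.
  rewrite -(ler_pM2r ct1) (le_trans (gap_decay t0))//.
  by move: tl; rewrite ler_pdivrMr ?mulr_gt0//; lra.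
- by move=> x x0; apply: derivableN; have [] := is_derive_step x0.
- by apply: cvgN; exact: cvg_right_step.
- move=> x; rewrite in_itv/= andbT => x0.
  have [d1 d2] := is_derive_step x0.
  by rewrite derive1E deriveN// d2 opprK.
Unshelve. all: by end_near. Qed.

End Dissipation.

(** * Independence *)

Section IndependenceFacts.
Context {d : measure_display} {T : measurableType d} {R : realType}.
Variable Pr : probability T R.

(** The product rule indexed by a duplicate-free sequence, the form in
    which the increments and the clocks are enumerated. *)
Lemma mutually_independent_seq {I : choiceType} (F : I -> set (set T))
    (r : seq I) (A : I -> set T) :
  mutually_independent Pr F -> uniq r -> (forall i, i \in r -> F i (A i)) ->
  Pr (\bigcap_(i in [set` r]) A i) = (\prod_(i <- r) Pr (A i))%E.
Proof.
move=> ind ur FA; have JE : [fset x in r]%fset =i r by move=> x; rewrite in_fset.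
rewrite (_ : [set` r] = [set` [fset x in r]%fset]); last first.
  by apply/seteqP; split => x /=; rewrite JE.
rewrite ind => [|i]; last by rewrite JE; exact: FA.
by apply: perm_big; apply: uniq_perm => //; exact: fset_uniq.
Qed.

Lemma sigma_of_preimage {d'} {U : measurableType d'} {I : Type} (D : set I)
    (X : I -> T -> U) i (A : set U) : D i -> measurable A ->
  sigma_of D X (X i @^-1` A).
Proof.
move=> Di mA; apply: sub_sigma_algebra; exists i => //; exists A => //.
by rewrite setTI.
Qed.

Lemma measurable_sigma_of {d'} {U : measurableType d'} {I : Type} (D : set I)
    (X : I -> T -> U) i : D i ->
  measurable_fun [set: g_sigma_algebraType
      (\bigcup_(i in D) preimage_set_system setT (X i) measurable)] (X i).
Proof.
move=> Di _ A mA; rewrite setTI. exact: (@sigma_of_preimage _ _ _ D X i A Di mA).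
Qed.

(** Layer-cake formula: both means are integrals over r >= 0 of tail
    probabilities, and 1_H X exceeds r >= 0 exactly on H when X does. *)
Lemma expectation_indep_event (X : T -> R) (H : set T) (q : R) :
  measurable_fun setT X -> (forall w, 0 <= X w) -> measurable H -> 0 <= q ->
  (forall A : set R, measurable A -> Pr (X @^-1` A `&` H) = (q%:E * Pr (X @^-1` A))%E) ->
  ('E_Pr[fun w => (\1_H w * X w)%R] = q%:E * 'E_Pr[X])%E.
Proof.
move=> mX X0 mH q0 ind.
have mXH : measurable_fun setT (fun w => \1_H w * X w).
  by apply: measurable_funM => //; exact: measurable_indic.
pose X1 : {RV Pr >-> R} := HB.pack X (isMeasurableFun.Build _ _ _ _ X mX).
pose X2 : {RV Pr >-> R} := HB.pack (fun w => \1_H w * X w)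
  (isMeasurableFun.Build _ _ _ _ (fun w => \1_H w * X w) mXH).
change ('E_Pr[X2] = q%:E * 'E_Pr[X1])%E.
rewrite (@ge0_expectation_ccdf _ _ _ _ X2) => [|w]; last first.
  by rewrite /= mulr_ge0// indicE; case: (_ \in _).
rewrite (@ge0_expectation_ccdf _ _ _ _ X1)//.
rewrite -ge0_integralZl//; last first.
- by apply: measurable_funTS; exact: ccdf_measurable.
apply: eq_integral => r; rewrite inE/= in_itv/= andbT => r0.
rewrite /ccdf /distribution /pushforward/= -ind//; congr (Pr _).
apply/seteqP; split => w /=; rewrite !in_itv/= !andbT.
  have [wH|wH] := boolP (w \in H).
    by rewrite indicE wH mul1r => ?; split => //; exact/set_mem.
  by rewrite indicE (negbTE wH) mul0r ltNge r0.
by move=> [? wH]; rewrite indicE mem_set// mul1r.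
Qed.

End IndependenceFacts.

(** Stated for any measurable space because it is used both on T and on T
    equipped with the sigma-algebra of a single clock. *)
Lemma measurable_increment d (U : measurableType d) (f g : U -> nat) (m : nat) :
  measurable_fun setT f -> measurable_fun setT g ->
  measurable [set u | (g u - f u)%N = m].
Proof.
move=> mf mg.
rewrite (_ : mkset _ =
  \bigcup_j ((f @^-1` [set j]) `&` (g @^-1` [set x | (x - j)%N = m]))).
  apply: bigcupT_measurable => j; apply: measurableI; rewrite -[X in measurable X]setTI.
    exact: mf.
  exact: mg.
by apply/seteqP; split=> [u /= <-|u [j _ [/= <-]]]//; exists (f u).
Qed.

(** * Words of rings and their probabilities *)

Section Words.
Context {R : realType} {n : nat}.
Implicit Types (P : 'M[R]_n) (y : 'I_n -> R) (s : seq (option 'I_n)).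

(** Probability that in a cell of length h no clock rings (None), or only
    clock k, exactly once (Some k). *)
Definition weight (h : R) (o : option 'I_n) : R :=
  expR (- (n%:R * h)) * (if o is Some _ then h else 1).

Lemma weightE h o : 0 < h ->
  weight h o = \prod_(k < n) poisson_pmf h (o == Some k).
Proof.
move=> h0; rewrite /poisson_pmf h0.
have -> : \prod_(k < n) (h ^+ (o == Some k) / ((o == Some k)`!)%:R * expR (- h)) =
    \prod_(k < n) (expR (- h) * h ^+ (o == Some k)).
  by apply: eq_bigr => k _; case: (o == Some k); rewrite divr1 mulrC.
rewrite big_split/= prodr_const card_ord -expRM_natl mulrN /weight; congr (_ * _).
case: o => [k|]; last by rewrite big1.
rewrite (bigD1 k)//= eqxx big1 ?mulr1// => i ik.
by rewrite (_ : Some k == Some i = false)//; apply: contraNF ik => /eqP[->].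
Qed.

Lemma weight_ge0 h o : 0 <= h -> 0 <= weight h o.
Proof. by move=> h0; rewrite mulr_ge0 ?expR_ge0//; case: o. Qed.

Definition run P s y : 'I_n -> R := foldl (fun z o => update P o z) y s.

Lemma run_rcons P s o y : run P (rcons s o) y = update P o (run P s y).
Proof. by rewrite /run foldl_rcons. Qed.

(** Words grow on the right, in the order of time, so that the last letter
    is the last cell of the grid. *)
Fixpoint words m : seq (seq (option 'I_n)) :=
  if m is m'.+1 then [seq rcons s o | s <- words m', o <- enum {: option 'I_n}]
  else [:: [::]].

Lemma size_words m s : s \in words m -> size s = m.
Proof.
elim: m s => [|m IH] s /=; first by rewrite inE => /eqP->.
by move=> /allpairsP[[s' o] /= [s'm _ ->]]; rewrite size_rcons IH.
Qed.

Lemma sum_words m (F : seq (option 'I_n) -> R) :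
  \sum_(s <- words m.+1) F s = \sum_(s <- words m) \sum_o F (rcons s o).
Proof.
rewrite /= big_allpairs_dep/=; apply: eq_bigr => s _.
by rewrite big_enum.
Qed.

Definition word_weight (tau : nat -> R) s : R :=
  \prod_(i < size s) weight (tau i.+1 - tau i) (nth None s i).

Lemma word_weight_rcons tau s o :
  word_weight tau (rcons s o) =
  word_weight tau s * weight (tau (size s).+1 - tau (size s)) o.
Proof.
rewrite /word_weight size_rcons big_ord_recr/= nth_rcons ltnn eqxx.
by congr (_ * _); apply: eq_bigr => i _; rewrite nth_rcons ltn_ord.
Qed.

Lemma word_weight_ge0 tau s : (forall i, tau i < tau i.+1) -> 0 <= word_weight tau s.
Proof.
by move=> tau_lt; apply: prodr_ge0 => i _; rewrite weight_ge0// subr_ge0 ltW.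
Qed.

Definition grid (tau : nat -> R) : Prop := tau 0%N = 0 /\ forall i, tau i < tau i.+1.

Lemma grid_le tau : grid tau -> forall i j, (i <= j)%N -> tau i <= tau j.
Proof.
move=> [_ tau_lt] i j /subnK <-; elim: (j - i)%N => [//|m IH].
by rewrite (le_trans IH)// ltW.
Qed.

Lemma grid_ge0 tau i : grid tau -> 0 <= tau i.
Proof. by move=> g; rewrite -g.1; exact: grid_le. Qed.

End Words.

Section Process.
Context {d : measure_display} {T : measurableType d} {R : realType}.
Context {Pr : probability T R} {n : nat} {P : 'M[R]_n}.
Context {N : 'I_n -> R -> {RV Pr >-> nat}} {Y : R -> 'I_n -> {RV Pr >-> R}}.
Hypothesis hY : smoothing_process P N Y.

Definition state t w : 'I_n -> R := fun k => Y t k w.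

Definition regular_path w : Prop :=
  (forall k, counting_path (fun t => N k t w)) /\
  smoothing_path P (fun k t => N k t w) (fun t k => Y t k w).

Lemma ae_regular_path : {ae Pr, forall w, regular_path w}.
Proof.
have [hN _ hp] := hY.
have hc : {ae Pr, forall w, forall k, counting_path (fun t => N k t w)}.
  apply: filter_forall => k; have [h _ _] := hN k.
  by apply: filterS h => w [_ h1 h2]; split.
by apply: filterS2 hc hp.
Qed.

Section Grid.
Variable tau : nat -> R.
Hypothesis gtau : grid tau.

(** Counts, rather than ring times, describe the cell: exactly one ring at k
    for Some k, none for None.  Cells with several rings match no letter. *)
Definition tick i (o : option 'I_n) : set T :=
  [set w | forall k, (N k (tau i.+1) w - N k (tau i) w)%N = (o == Some k)].

Definition history (s : seq (option 'I_n)) : set T :=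
  [set w | forall i, (i < size s)%N -> tick i (nth None s i) w].

Lemma history_rcons s o :
  history (rcons s o) = history s `&` tick (size s) o.
Proof.
apply/seteqP; split => w /=.
  move=> h; split => [i iS|].
    by have := h i; rewrite size_rcons nth_rcons iS ltnS ltnW// => /(_ isT).
  by have := h (size s); rewrite size_rcons nth_rcons ltnn eqxx ltnSn => /(_ isT).
move=> [h1 h2] i; rewrite size_rcons ltnS nth_rcons leq_eqVlt => /orP[/eqP ->|iS].
  by rewrite ltnn eqxx.
by rewrite iS; exact: h1.
Qed.

Lemma state_history s w : regular_path w -> history s w ->
  state (tau (size s)) w = run P s (state 0 w).
Proof.
move=> [cw sw]; elim/last_ind: s => [|s o IH]; first by rewrite gtau.1.
rewrite history_rcons => -[hs ho]; rewrite run_rcons -IH// size_rcons.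
apply: (smoothing_path_update cw sw) => //.
by rewrite grid_ge0//= gtau.2.
Qed.

Let site_history s k : set T :=
  [set w | forall i, (i < size s)%N ->
     (N k (tau i.+1) w - N k (tau i) w)%N = (nth None s i == Some k)].

Let measurable_site_history d' (U : measurableType d') (M : nat -> U -> nat)
    (s : seq (option 'I_n)) k :
  (forall i, measurable_fun setT (M i)) ->
  measurable [set w | forall i, (i < size s)%N ->
     (M i.+1 w - M i w)%N = (nth None s i == Some k)].
Proof.
move=> mM; rewrite (_ : mkset _ = \bigcap_(i in [set i | (i < size s)%N])
  [set w | (M i.+1 w - M i w)%N = (nth None s i == Some k)])//.
by apply: bigcap_measurableType => i _; exact: measurable_increment.
Qed.

Lemma measurable_history s : measurable (history s).
Proof.
rewrite (_ : history s = \bigcap_(k in [set: 'I_n]) site_history s k).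
  apply: fin_bigcap_measurable => // k _.
  by apply: (measurable_site_history (M := fun i => N k (tau i))) => i.
by apply/seteqP; split=> w /= h => [k _ i iS|i iS k]; exact: h.
Qed.

Let prob_site_history s k : Pr (site_history s k) =
  (\prod_(i < size s) poisson_pmf (tau i.+1 - tau i) (nth None s i == Some k))%:E.
Proof.
have [hN _ _] := hY; have [_ hpois hind] := hN k.
have {}hind := hind tau (grid_ge0 0 gtau) (grid_le gtau).
pose A i := [set w | (N k (tau i.+1) w - N k (tau i) w)%N = (nth None s i == Some k)].
rewrite (_ : site_history s k = \bigcap_(i in [set` iota 0 (size s)]) A i); last first.
  apply/seteqP; split=> w h i; first by rewrite /= mem_iota add0n => iS; exact: h.
  by move=> iS; apply: h; rewrite /= mem_iota.
rewrite (mutually_independent_seq hind) ?iota_uniq//; last first.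
  move=> i _; rewrite /A.
  exact: (@sigma_of_preimage _ _ _ _ _ [set: unit]
    (fun _ w => N k (tau i.+1) w - N k (tau i) w)%N tt
    [set (nth None s i == Some k) : nat]).
rewrite -prodEFin -[in LHS](subn0 (size s)) -/(index_iota _ _) big_mkord.
apply: eq_bigr => i _; apply: hpois.
by rewrite grid_ge0//= gtau.2.
Qed.

(** The event splits into one event for the initial state and one for each
    clock, and the event of each clock into its increments over the cells. *)
Lemma prob_history s C : sigma_of [set: 'I_n] (Y 0) C ->
  Pr (C `&` history s) = ((word_weight tau s)%:E * Pr C)%E.
Proof.
move=> hC; have [hN hind _] := hY.
pose A (o : option 'I_n) := if o is Some k then site_history s k else C.
rewrite (_ : C `&` history s = \bigcap_(o in [set` enum {: option 'I_n}]) A o); last first.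
  apply/seteqP; split=> w /=.
    by move=> [Cw h] [k|] _ //= i iS; exact: h.
  move=> h; split; first by apply: (h None); rewrite /= mem_enum.
  by move=> i iS k; apply: (h (Some k)) => //; rewrite /= mem_enum.
rewrite (mutually_independent_seq hind) ?enum_uniq//; last first.
  move=> [k|] _ //=.
  pose M i : g_sigma_algebraType (\bigcup_(t in [set t : R | 0 <= t])
     preimage_set_system setT (N k t) measurable) -> nat := N k (tau i).
  apply: (measurable_site_history (M := M)) => i.
  apply: (@measurable_sigma_of _ _ _ _ _ [set t : R | 0 <= t] (N k) (tau i)).
  exact: grid_ge0.
rewrite big_enum (bigD1 None)//= muleC; congr (_ * _)%E.
rewrite (reindex_omap Some id)/=; last by case.
rewrite (eq_bigl xpredT) => [|k]; last by rewrite eqxx.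
under eq_bigr do rewrite prob_site_history.
rewrite prodEFin; congr (_%:E); rewrite exchange_big/=.
by apply: eq_bigr => i _; rewrite weightE// subr_gt0 gtau.2.
Qed.

End Grid.
End Process.

(** * Borel functionals of the state, and means of bounded variables *)

Section BorelFunctional.
Context {R : realType} {n : nat}.
Implicit Types (P : 'M[R]_n) (y : 'I_n -> R) (f : ('I_n -> R) -> R).

(** Measurability is required for every measurable space of parameters, not
    just for T, so that it can be applied to the sigma-algebra generated by the
    initial state. *)
Definition borel_functional f : Prop :=
  forall d (U : measurableType d) (X : U -> 'I_n -> R),
    (forall k, measurable_fun setT (fun u => X u k)) ->
    measurable_fun setT (fun u => f (X u)).

Lemma borel_coord k : borel_functional (fun y => y k).
Proof. by move=> d U X; apply. Qed.

Lemma borel_cst c : borel_functional (fun=> c).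
Proof. by move=> d U X _; exact: measurable_cst. Qed.

Lemma borelM f g : borel_functional f -> borel_functional g ->
  borel_functional (fun y => f y * g y).
Proof. by move=> bf bg d U X mX; apply: measurable_funM; [exact: bf|exact: bg]. Qed.

Lemma borelB f g : borel_functional f -> borel_functional g ->
  borel_functional (fun y => f y - g y).
Proof. by move=> bf bg d U X mX; apply: measurable_funB; [exact: bf|exact: bg]. Qed.

Lemma borelX f m : borel_functional f -> borel_functional (fun y => f y ^+ m).
Proof. by move=> bf d U X mX; apply: measurable_funX; exact: bf. Qed.

Lemma borel_sum {I : Type} (r : seq I) (g : I -> ('I_n -> R) -> R) :
  (forall i, borel_functional (g i)) -> borel_functional (fun y => \sum_(i <- r) g i y).
Proof. by move=> bg d U X mX; apply: measurable_sum => i; exact: bg. Qed.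

Lemma borel_update P o f : borel_functional f ->
  borel_functional (fun y => f (update P o y)).
Proof.
move=> bf d U X mX; apply: (bf _ _ (fun u => update P o (X u))) => i.
case: o => [k|] //=; case: (i == k) => //.
apply: (@borel_sum _ _ (fun j y => P k j * y j)) => // j.
exact: borelM (borel_cst _) (borel_coord j).
Qed.

Lemma borel_run P s f : borel_functional f ->
  borel_functional (fun y => f (run P s y)).
Proof.
elim: s => //= o s IH bf; exact: (borel_update P o (IH bf)).
Qed.

Variable M : R.

Definition box y : bool := [forall k, `|y k| <= M].

Lemma borel_box : borel_functional (fun y => (box y)%:R).
Proof.
move=> d U X mX.
have mB : measurable [set u | box (X u)].
  rewrite (_ : mkset _ = \bigcap_(k in [set: 'I_n]) [set u | `|X u k| <= M]).
    apply: fin_bigcap_measurable => // k _.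
    rewrite -[X in measurable X]setTI; apply: measurable_fun_le => //.
    by apply: measurableT_comp => //; exact: mX.
  apply/seteqP; split=> u /=; first by move=> /forallP h k _; exact: h.
  by move=> h; apply/forallP => k; exact: h.
apply: eq_measurable_fun (measurable_indic mB) => u _.
by rewrite indicE; congr ((_ : bool)%:R); apply/idP/idP => [/set_mem|/mem_set].
Qed.

(** The updated value is a convex combination of values in [-M, M]. *)
Lemma box_update P o y : transition_matrix P -> box y -> box (update P o y).
Proof.
move=> [P0 P1] /forallP by_; apply/forallP => i; case: o => [k|] //=.
case: ifP => // _; apply: (le_trans (ler_norm_sum _ _ _)).
rewrite -[leRHS]mul1r -(P1 k) mulr_suml; apply: ler_sum => j _.
by rewrite normrM ger0_norm// ler_wpM2l.
Qed.

Lemma box_run P s y : transition_matrix P -> box y -> box (run P s y).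
Proof.
by move=> tP; elim: s y => //= o s IH y by_; apply: IH; exact: box_update.
Qed.

Definition admissible f (C : R) : Prop :=
  borel_functional f /\ forall y, box y -> 0 <= f y <= C.

Lemma admissible_update P o f C : transition_matrix P ->
  admissible f C -> admissible (fun y => f (update P o y)) C.
Proof.
move=> tP [bf fC]; split; first exact: borel_update.
by move=> y by_; apply: fC; exact: box_update.
Qed.

End BorelFunctional.

Section Mean.
Context {d : measure_display} {T : measurableType d} {R : realType}.
Variable Pr : probability T R.
Implicit Types (Z : T -> R).

Definition mean Z : R := \int[Pr]_w Z w.

Definition bounded_rv Z : Prop :=
  measurable_fun setT Z /\ exists C, forall w, `|Z w| <= C.

Lemma bounded_rv_integrable Z : bounded_rv Z -> Pr.-integrable setT (EFin \o Z).
Proof.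
move=> [mZ [C hC]]; apply: measurable_bounded_integrable => //.
  exact: (le_lt_trans (probability_le1 Pr measurableT) (ltry 1)).
exists C; split; first by rewrite num_real.
by move=> x Cx w _; exact: (le_trans (hC w) (ltW Cx)).
Qed.

Lemma bounded_rv_cst c : bounded_rv (fun=> c).
Proof. by split; [exact: measurable_cst|exists `|c|]. Qed.

Lemma bounded_rvD Z Z' : bounded_rv Z -> bounded_rv Z' ->
  bounded_rv (fun w => Z w + Z' w).
Proof.
move=> [mZ [C hC]] [mZ' [C' hC']]; split; first exact: measurable_funD.
by exists (C + C') => w; rewrite (le_trans (ler_normD _ _))// lerD.
Qed.

Lemma bounded_rvM Z Z' : bounded_rv Z -> bounded_rv Z' ->
  bounded_rv (fun w => Z w * Z' w).
Proof.
move=> [mZ [C hC]] [mZ' [C' hC']]; split; first exact: measurable_funM.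
by exists (C * C') => w; rewrite normrM ler_pM.
Qed.

Lemma bounded_rv_sum {I : Type} (r : seq I) (Z : I -> T -> R) :
  (forall i, bounded_rv (Z i)) -> bounded_rv (fun w => \sum_(i <- r) Z i w).
Proof.
move=> hZ; elim: r => [|i r IH].
  by under [X in bounded_rv X]funext do rewrite big_nil; exact: bounded_rv_cst.
by under [X in bounded_rv X]funext do rewrite big_cons; exact: bounded_rvD.
Qed.

Lemma bounded_rv_indic (A : set T) : measurable A -> bounded_rv (\1_A : T -> R).
Proof.
move=> mA; split; first exact: measurable_indic.
by exists 1 => w; rewrite indicE; case: (_ \in _); rewrite ?normr1 ?normr0.
Qed.

Lemma eq_mean Z Z' : Z =1 Z' -> mean Z = mean Z'.
Proof. by move=> /funext ->. Qed.

Lemma mean_cst c : mean (fun=> c) = c.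
Proof.
rewrite /mean Rintegral_cst// -[RHS]mulr1; congr (c * _).
exact: (congr1 fine (@probability_setT _ _ _ Pr)).
Qed.

Lemma meanD Z Z' : bounded_rv Z -> bounded_rv Z' ->
  mean (fun w => Z w + Z' w) = mean Z + mean Z'.
Proof. by move=> hZ hZ'; apply: RintegralD => //; exact: bounded_rv_integrable. Qed.

Lemma meanZ c Z : bounded_rv Z -> mean (fun w => c * Z w) = c * mean Z.
Proof. by move=> hZ; apply: RintegralZl => //; exact: bounded_rv_integrable. Qed.

Lemma mean_sum {I : Type} (r : seq I) (Z : I -> T -> R) :
  (forall i, bounded_rv (Z i)) ->
  mean (fun w => \sum_(i <- r) Z i w) = \sum_(i <- r) mean (Z i).
Proof.
move=> hZ; elim: r => [|i r IH].
  by rewrite big_nil -[RHS]mean_cst; apply: eq_mean => w; rewrite big_nil.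
rewrite big_cons -IH -meanD//; last exact: bounded_rv_sum.
by apply: eq_mean => w; rewrite big_cons.
Qed.

Lemma le_mean Z Z' : bounded_rv Z -> bounded_rv Z' ->
  (forall w, Z w <= Z' w) -> mean Z <= mean Z'.
Proof.
by move=> hZ hZ' le; apply: le_Rintegral => //; exact: bounded_rv_integrable.
Qed.

Lemma mean_ge0 Z : (forall w, 0 <= Z w) -> 0 <= mean Z.
Proof. by move=> Z0; exact: Rintegral_ge0. Qed.

Lemma ae_eq_mean Z Z' : measurable_fun setT Z -> measurable_fun setT Z' ->
  {ae Pr, forall w, Z w = Z' w} -> mean Z = mean Z'.
Proof.
move=> mZ mZ' h; congr fine; apply: ae_eq_integral => //.
- exact/measurable_EFinP.
- exact/measurable_EFinP.
- by apply: filterS h => w /= ->.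
Qed.

Lemma EFin_mean Z : bounded_rv Z -> (mean Z)%:E = 'E_Pr[Z]%E.
Proof.
move=> hZ; rewrite unlock /mean /Rintegral fineK//.
by apply: integrable_fin_num => //; exact: bounded_rv_integrable.
Qed.

Lemma mean_indic (A : set T) : measurable A -> (mean (\1_A : T -> R))%:E = Pr A.
Proof.
move=> mA; rewrite EFin_mean; last exact: bounded_rv_indic.
by rewrite expectation_indic.
Qed.

End Mean.

(** * The one-step estimate *)

Section Mass.
Context {R : realType} {n : nat}.
Implicit Types (h : R) (tau : nat -> R).

Lemma sum_weight h :
  \sum_(o : option 'I_n) weight h o = expR (- (n%:R * h)) * (1 + n%:R * h).
Proof.
rewrite (bigD1 None)//= /weight mulr1 mulrDr mulr1; congr (_ + _).
rewrite (reindex_omap Some id)/=; last by case.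
rewrite (eq_bigl xpredT) => [|k]; last by rewrite eqxx.
by rewrite sumr_const card_ord -[LHS]mulr_natl mulrCA.
Qed.

(** With x = n h the sum is exp (- x) (1 + x), and
    1 - x^2 = (1 - x) (1 + x) <= exp (- x) (1 + x) <= 1. *)
Lemma sum_weight_bounds h : 0 <= h ->
  1 - (n%:R * h) ^+ 2 <= \sum_(o : option 'I_n) weight h o <= 1.
Proof.
move=> h0; rewrite sum_weight; set x := n%:R * h.
have x0 : 0 <= x by rewrite mulr_ge0.
apply/andP; split.
  rewrite (_ : 1 - x ^+ 2 = (1 - x) * (1 + x)); last by ring.
  by rewrite ler_wpM2r ?addr_ge0// expR_ge1Dx.
rewrite expRN ler_pdivrMl ?expR_gt0// mulr1.
exact: expR_ge1Dx.
Qed.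

(** Probability that the history over the first m cells is described by a
    word. *)
Definition word_mass tau m : R := \sum_(s <- @words n m) word_weight tau s.

Lemma word_massS tau m : word_mass tau m.+1 =
  word_mass tau m * \sum_(o : option 'I_n) weight (tau m.+1 - tau m) o.
Proof.
rewrite /word_mass sum_words mulr_suml big_seq [RHS]big_seq; apply: eq_bigr => s sm.
rewrite mulr_sumr; apply: eq_bigr => o _.
by rewrite word_weight_rcons (size_words sm).
Qed.

Lemma word_mass_ge tau m : (forall i, tau i < tau i.+1) ->
  1 - n%:R ^+ 2 * \sum_(i < m) (tau i.+1 - tau i) ^+ 2 <= word_mass tau m <= 1.
Proof.
move=> tau_lt; elim: m => [|m /andP[IH1 IH2]].
  by rewrite /word_mass/= big_seq1 /word_weight !big_ord0 mulr0 subr0 lexx.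
rewrite word_massS big_ord_recr/=.
have m0 : 0 <= word_mass tau m by apply: sumr_ge0 => s _; exact: word_weight_ge0.
have /sum_weight_bounds : 0 <= tau m.+1 - tau m by rewrite subr_ge0 ltW.
set q := \sum_o _; set h := tau m.+1 - tau m => /andP[q1 q2].
apply/andP; split.
  (* 1 - a b <= (1 - a) + (1 - b) for a, b in [0, 1] *)
  suff : (1 - word_mass tau m) + (1 - q) >= 1 - word_mass tau m * q.
    by rewrite exprMn in q1; lra.
  have : 0 <= (1 - word_mass tau m) * (1 - q) by rewrite mulr_ge0; lra.
  by lra.
rewrite (le_trans (ler_wpM2l m0 q2))//; lra.
Qed.

(** The interval [0, t] is cut into many equal cells, whose squared lengths
    have a small sum, and followed by cells of length e.  For t = 0 there is
    nothing to cut. *)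
Lemma fine_grid (t e eps : R) : 0 <= t -> 0 < e -> 0 < eps ->
  exists tau m, [/\ grid tau, tau m = t, tau m.+1 = t + e &
    \sum_(i < m) (tau i.+1 - tau i) ^+ 2 <= eps].
Proof.
rewrite le_eqVlt => /orP[/eqP <-|t0] e0 eps0.
  exists (fun i => i%:R * e), 0%N; split; rewrite ?mul0r ?mul1r ?add0r//.
  - by split=> [|i]; rewrite ?mul0r// ltr_pM2r// ltr_nat.
  - by rewrite big_ord0 ltW.
(* m equal cells of [0, t] have squared lengths of sum t^2 / m *)
pose m := (Num.bound (t ^+ 2 / eps)).+1.
have m0 : (0 : R) < m%:R by rewrite ltr0n.
have hm : t ^+ 2 / m%:R <= eps.
  rewrite ler_pdivrMr// mulrC -ler_pdivrMr//.
  have := archi_boundP (divr_ge0 (sqr_ge0 t) (ltW eps0)).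
  by move=> /ltW/le_trans; apply; rewrite ler_nat.
pose tau i : R := if (i <= m)%N then i%:R * (t / m%:R) else t + (i - m)%:R * e.
have tm : tau m = t by rewrite /tau leqnn mulrC divfK// gt_eqF.
have step i : (i < m)%N -> tau i.+1 - tau i = t / m%:R.
  by move=> im; rewrite /tau im ltnW// -natr1; ring.
exists tau, m; split => //.
- split=> [|i]; first by rewrite /tau leq0n mul0r.
  have [im|mi] := ltnP i m; first by rewrite -subr_gt0 step// divr_gt0.
  have -> : tau i = t + (i - m)%:R * e.
    move: mi; rewrite leq_eqVlt => /orP[/eqP <-|mi]; last by rewrite /tau leqNgt mi.
    by rewrite tm subnn mul0r addr0.
  by rewrite /tau leqNgt ltnS mi/= ltrD2l ltr_pM2r// ltr_nat subSn.
- by rewrite /tau ltnn subSnn mul1r.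
- rewrite (eq_bigr (fun=> (t / m%:R) ^+ 2)) => [|i _]; last by rewrite step.
  rewrite sumr_const card_ord -[leLHS]mulr_natl.
  rewrite (_ : m%:R * _ = t ^+ 2 / m%:R)//.
  by move: (m%:R : R) m0 => x x0; field; rewrite gt_eqF.
Qed.

End Mass.

Section Approximation.
Context {d : measure_display} {T : measurableType d} {R : realType}.
Context {Pr : probability T R} {n : nat} {P : 'M[R]_n}.
Context {N : 'I_n -> R -> {RV Pr >-> nat}} {Y : R -> 'I_n -> {RV Pr >-> R}}.
Hypothesis hP : transition_matrix P.
Hypothesis hY : smoothing_process P N Y.
Variable M : R.
Local Notation box := (@box R n M).
Local Notation state := (@state d T R Pr n Y).
Local Notation history := (@history d T R Pr n N).
Local Notation tick := (@tick d T R Pr n N).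
Local Notation admissible := (@admissible R n M).
Local Notation mean := (mean Pr).

Lemma state_borel t f : borel_functional f ->
  measurable_fun setT (fun w => f (state t w)).
Proof. by move=> bf; apply: bf => k. Qed.

Definition start_box w : R := (box (state 0 w))%:R.

Lemma start_box01 w : 0 <= start_box w <= 1.
Proof. by rewrite /start_box; case: (box _); rewrite ?lexx ler01. Qed.

Lemma bounded_start_box : bounded_rv start_box.
Proof.
split; first by apply: (@state_borel 0 (fun y => (box y)%:R)); exact: borel_box.
by exists 1 => w; rewrite /start_box; case: (box _); rewrite ?normr1 ?normr0.
Qed.

Definition boxed (f : ('I_n -> R) -> R) y : R := (box y)%:R * f y.

Lemma boxed01 f C y : 0 <= C -> admissible f C -> 0 <= boxed f y <= C.
Proof.
move=> C0 [_ fC]; rewrite /boxed; have [/fC|_] := boolP (box y).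
  by rewrite mul1r.
by rewrite mul0r lexx.
Qed.

Lemma bounded_boxed f C t : 0 <= C -> admissible f C ->
  bounded_rv (fun w => boxed f (state t w)).
Proof.
move=> C0 af; split.
  by apply: state_borel; apply: borelM => //; [exact: borel_box|exact: af.1].
exists C => w; have /andP[h1 h2] := boxed01 (state t w) C0 af.
by rewrite ger0_norm.
Qed.

(** Mean of f (Y t) on the event that both the initial and the current
    state are in the box. *)
Definition truncated_mean t f : R := mean (fun w => start_box w * boxed f (state t w)).

(** Mean that truncated_mean would have at the m-th grid time if every
    history were described by a word. *)
Definition word_mean tau m f : R :=
  \sum_(s <- words m) word_weight tau s *
     mean (fun w => start_box w * boxed f (run P s (state 0 w))).

Lemma bounded_boxed_run f C s : 0 <= C -> admissible f C ->
  bounded_rv (fun w => start_box w * boxed f (run P s (state 0 w))).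
Proof.
move=> C0 af; apply: bounded_rvM; first exact: bounded_start_box.
split.
  apply: (@state_borel 0 (fun y => boxed f (run P s y))).
  by apply: borel_run; apply: borelM => //; [exact: borel_box|exact: af.1].
exists C => w; have /andP[h1 h2] := boxed01 (run P s (state 0 w)) C0 af.
by rewrite ger0_norm.
Qed.

(** Conditioning on the last letter; by box_run the truncation is unaffected
    by the updates. *)
Lemma word_meanS tau m f : word_mean tau m.+1 f =
  \sum_o weight (tau m.+1 - tau m) o * word_mean tau m (fun y => f (update P o y)).
Proof.
rewrite /word_mean sum_words.
under [RHS]eq_bigr do rewrite mulr_sumr.
rewrite [RHS]exchange_big/= big_seq [RHS]big_seq; apply: eq_bigr => s sm.
apply: eq_bigr => o _; rewrite word_weight_rcons (size_words sm).
rewrite [word_weight _ _ * _]mulrC -mulrA; congr (_ * (_ * _)).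
apply: eq_mean => w; rewrite run_rcons /start_box /boxed.
have [by_|_] := boolP (box (state 0 w)); last by rewrite !mul0r.
by rewrite !box_run// ?box_update ?box_run.
Qed.

Section Grid.
Variables (tau : nat -> R) (m : nat).
Hypothesis gtau : grid tau.
Local Notation hist := (history tau).

Let mh s : measurable (hist s). Proof. exact: measurable_history. Qed.

(** The integrand is a Borel function of the initial state, which is
    independent of the rings. *)
Lemma mean_history f C s : 0 <= C -> admissible f C ->
  mean (fun w => \1_(hist s) w * (start_box w * boxed f (run P s (state 0 w)))) =
  word_weight tau s * mean (fun w => start_box w * boxed f (run P s (state 0 w))).
Proof.
move=> C0 af; have bZ := bounded_boxed_run s C0 af.
set Z := fun w => start_box w * boxed f (run P s (state 0 w)).
have bF : borel_functional (fun y => (box y)%:R * boxed f (run P s y)).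
  apply: borelM; first exact: borel_box.
  apply: (@borel_run R n P s (boxed f)); apply: borelM; first exact: borel_box.
  exact: af.1.
apply: EFin_inj; rewrite EFinM !EFin_mean//; last first.
  by apply: bounded_rvM => //; exact: bounded_rv_indic.
apply: expectation_indep_event => //.
- exact: bZ.1.
- move=> w; have /andP[s0 _] := start_box01 w.
  by have /andP[b0 _] := boxed01 (run P s (state 0 w)) C0 af; exact: mulr_ge0.
- by apply: word_weight_ge0; exact: gtau.2.
- move=> A mA; apply: (prob_history hY gtau).
  pose X : g_sigma_algebraType (\bigcup_(k in [set: 'I_n])
     preimage_set_system setT (Y 0 k) measurable) -> 'I_n -> R := fun w k => Y 0 k w.
  have mX k : measurable_fun setT (fun w => X w k).
    exact: (@measurable_sigma_of _ _ _ _ _ [set: 'I_n] (Y 0) k I).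
  by have := bF _ _ X mX measurableT A mA; rewrite setTI.
Qed.

Let unhist w : R := 1 - \sum_(s <- words m) \1_(hist s) w.

Lemma sum_tick_le1 i w : \sum_(o : option 'I_n) (\1_(tick tau i o) w : R) <= 1.
Proof.
have [ [ o ho]|no] := pselect (exists o, tick tau i o w); last first.
  rewrite big1 ?ler01// => o _; rewrite indicE memNset// => ho.
  by apply: no; exists o.
rewrite (bigD1 o)//= big1 ?addr0.
  by rewrite indicE; case: (_ \in _); rewrite ?lexx ?ler01.
move=> o' oo'; rewrite indicE memNset// => ho'; move/eqP: oo'; apply.
have e k : (o == Some k) = (o' == Some k).
  by have := ho k; rewrite (ho' k); do 2 case: (_ == _).
case: o {ho} e => [k|] e; first by have := e k; rewrite eqxx => /esym/eqP.
case: o' e {ho'} => [k|//] e; by have := e k; rewrite eqxx.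
Qed.

Let sum_history01 k w : 0 <= \sum_(s <- words k) (\1_(hist s) w : R) <= 1.
Proof.
elim: k => [|k /andP[IH0 IH]].
  by rewrite /= big_seq1 indicE; case: (_ \in _); rewrite ?lexx ?ler01.
apply/andP; split; first by apply: sumr_ge0 => s _; rewrite /= indicE.
rewrite sum_words; apply: le_trans IH; rewrite big_seq [leRHS]big_seq.
apply: ler_sum => s sk.
under eq_bigr do rewrite history_rcons indicI.
rewrite -[leRHS]mulr1 -mulr_sumr ler_wpM2l//.
exact: sum_tick_le1.
Qed.

Lemma mean_sum_history : mean (fun w => \sum_(s <- words m) \1_(hist s) w) =
  @word_mass R n tau m.
Proof.
rewrite mean_sum => [|s]; last exact: bounded_rv_indic.
apply: eq_bigr => s _; apply: EFin_inj; rewrite mean_indic// -[hist s]setTI.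
rewrite (prob_history hY gtau); last exact: (@measurableT _ (g_sigma_algebraType _)).
by rewrite (_ : Pr setT = 1%E) ?mule1//; exact: probability_setT.
Qed.

(** Splitting the mean of Z according to the history costs at most the
   probability that no word describes the history. *)
Lemma mean_split Z C (v : seq (option 'I_n) -> R) : bounded_rv Z ->
  (forall w, 0 <= Z w <= C) ->
  (forall s, s \in words m -> mean (fun w => \1_(hist s) w * Z w) = v s) ->
  `|mean Z - \sum_(s <- words m) v s| <=
     C * (n%:R ^+ 2 * \sum_(i < m) (tau i.+1 - tau i) ^+ 2).
Proof.
move=> bZ ZC hv.
have bh s : bounded_rv (\1_(hist s) : T -> R) by exact: bounded_rv_indic.
have bu : bounded_rv unhist.
  apply: bounded_rvD; first exact: bounded_rv_cst.
  apply: (eq_ind _ bounded_rv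
    (bounded_rvM (bounded_rv_cst (-1)) (bounded_rv_sum (words m) bh))).
  by apply/funext => w; rewrite mulN1r.
have u0 w : 0 <= unhist w by rewrite subr_ge0; case/andP: (sum_history01 m w).
(* the difference is the mean of Z over the histories that no word describes *)
have -> : mean Z - \sum_(s <- words m) v s = mean (fun w => unhist w * Z w).
  rewrite big_seq -(eq_bigr _ hv) -big_seq -mean_sum => [|s]; last exact: bounded_rvM.
  apply/eqP; rewrite subr_eq; apply/eqP; rewrite -meanD; [|exact: bounded_rvM|].
    by apply: eq_mean => w; rewrite -mulr_suml -mulrDl subrK mul1r.
  by apply: bounded_rv_sum => s; exact: bounded_rvM.
rewrite ger0_norm; last first.
  by apply: mean_ge0 => w; rewrite mulr_ge0//; case/andP: (ZC w).
apply: (@le_trans _ _ (mean (fun w => C * unhist w))).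
  apply: le_mean => [||w]; [exact: bounded_rvM| |].
    by apply: bounded_rvM => //; exact: bounded_rv_cst.
  by rewrite mulrC ler_wpM2r//; case/andP: (ZC w).
rewrite meanZ//.
have C0 : 0 <= C by have /andP[] := ZC point; exact: le_trans.
rewrite ler_wpM2l//.
have -> : mean unhist = 1 - @word_mass R n tau m.
  rewrite -mean_sum_history -[in RHS](mean_cst Pr 1).
  apply/eqP; rewrite eq_sym subr_eq -meanD//; last exact: bounded_rv_sum.
  by apply/eqP/eq_mean => w; rewrite subrK.
by have /andP[h _] := @word_mass_ge R n tau m gtau.2; lra.
Qed.

Lemma truncated_mean_approx f C : 0 <= C -> admissible f C ->
  `|truncated_mean (tau m) f - word_mean tau m f| <=
     C * (n%:R ^+ 2 * \sum_(i < m) (tau i.+1 - tau i) ^+ 2).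
Proof.
move=> C0 af; have bZ : bounded_rv (fun w => start_box w * boxed f (state (tau m) w)).
  by apply: bounded_rvM; [exact: bounded_start_box|exact: bounded_boxed C0 af].
apply: mean_split => //.
  move=> w; have /andP[s0 s1] := start_box01 w.
  have /andP[b0 b1] := boxed01 (state (tau m) w) C0 af.
  by rewrite mulr_ge0//= -[leRHS]mul1r ler_pM.
move=> s sm; rewrite -(mean_history s C0 af); apply: ae_eq_mean.
- by apply: measurable_funM; [exact: measurable_indic|exact: bZ.1].
- apply: measurable_funM; first exact: measurable_indic.
  by have [] := bounded_boxed_run s C0 af.
- apply: filterS (ae_regular_path hY) => w rw.
  rewrite indicE; have [/set_mem hs|_] := boolP (w \in hist s); last by rewrite !mul0r.
  by rewrite -(size_words sm) (state_history gtau rw hs).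
Qed.

End Grid.

(** Compare both sides with the word means of a grid whose last cell is
    [t, t + e]: word_meanS relates these exactly.  The cells of [0, t] contribute
    an error that vanishes as the grid is refined; the last cell contributes the
    e^2. *)
Lemma truncated_mean_step f C t e : 0 <= C -> admissible f C -> 0 <= t -> 0 < e ->
  `|truncated_mean (t + e) f -
    \sum_o weight e o * truncated_mean t (fun y => f (update P o y))| <=
  C * n%:R ^+ 2 * e ^+ 2.
Proof.
move=> C0 af t0 e0; apply/ler_addgt0Pl => eps eps0.
pose K := C * n%:R ^+ 2.
have K0 : 0 <= K by rewrite mulr_ge0// exprn_ge0.
have e1 : 0 < eps / (2 * K + 1) by rewrite divr_gt0// ltr_wpDl// mulr_ge0.
have [tau [m [gtau tm tm1 hs]]] := fine_grid t0 e0 e1.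
set S := \sum_(i < m) _ in hs.
have A1 := truncated_mean_approx m.+1 gtau C0 af.
have te : t + e - t = e by ring.
rewrite big_ord_recr/= -/S tm tm1 te [C * _]mulrA -/K in A1.
have A2 o : `|truncated_mean t (fun y => f (update P o y)) -
    word_mean tau m (fun y => f (update P o y))| <= K * S.
  have := truncated_mean_approx m gtau C0 (admissible_update o hP af).
  by rewrite tm mulrA.
(* the weights of the last cell sum to at most 1 *)
have A3 : `|\sum_o weight e o * truncated_mean t (fun y => f (update P o y)) -
    word_mean tau m.+1 f| <= K * S.
  rewrite word_meanS tm tm1 te.
  rewrite -sumrB (le_trans (ler_norm_sum _ _ _))//.
  have /andP[_ w1] := @sum_weight_bounds R n e (ltW e0).
  have KS0 : 0 <= K * S by rewrite mulr_ge0// sumr_ge0// => i _; rewrite sqr_ge0.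
  apply: le_trans (_ : (\sum_(o : option 'I_n) weight e o) * (K * S) <= _).
    rewrite mulr_suml; apply: ler_sum => o _.
    have w0 := weight_ge0 o (ltW e0).
    by rewrite -mulrBr normrM ger0_norm// ler_wpM2l.
  by rewrite -[leRHS]mul1r ler_wpM2r.
rewrite -/K; have -> : truncated_mean (t + e) f -
    \sum_o weight e o * truncated_mean t (fun y => f (update P o y)) =
  (truncated_mean (t + e) f - word_mean tau m.+1 f) -
  (\sum_o weight e o * truncated_mean t (fun y => f (update P o y)) - word_mean tau m.+1 f).
  by ring.
rewrite (le_trans (ler_normB _ _))//.
have : 2 * K * S <= eps.
  have K1 : 0 <= 2 * K by rewrite mulr_ge0.
  apply: (le_trans (ler_wpM2l K1 hs)).
  by rewrite mulrCA ler_piMr ?(ltW eps0)// ler_pdivrMr ?ltr_wpDl// mul1r lerDl.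
by lra.
Qed.

End Approximation.

(** * Variance and dissipation of the truncated process *)

Section Functionals.
Context {R : realType} {n : nat}.
Variables (P : 'M[R]_n) (p : 'I_n -> R).
Hypotheses (hP : transition_matrix P) (hp : probability_vector p)
  (hrev : reversible P p).

Lemma borel_variance : borel_functional (variance_fun p).
Proof.
apply: (@borel_sum _ _ _ _ (fun i y => p i * (y i - wmean p y) ^+ 2)) => i.
apply: borelM; first exact: borel_cst.
apply: borelX; apply: borelB; first exact: borel_coord.
apply: (@borel_sum _ _ _ _ (fun i y => p i * y i)) => j.
by apply: borelM; [exact: borel_cst|exact: borel_coord].
Qed.

Lemma dissipationE y : dissipation P p y =
  n%:R * variance_fun p y - \sum_k variance_fun p (update P (Some k) y).
Proof. by rewrite generator_variance// opprB addrC subrK. Qed.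

Lemma borel_dissipation : borel_functional (dissipation P p).
Proof.
rewrite (_ : dissipation P p = fun y =>
  n%:R * variance_fun p y - \sum_k variance_fun p (update P (Some k) y)); last first.
  by apply/funext => y; exact: dissipationE.
apply: borelB; first by apply: borelM; [exact: borel_cst|exact: borel_variance].
apply: (@borel_sum _ _ _ _ (fun k y => variance_fun p (update P (Some k) y))) => k.
by apply: borel_update; exact: borel_variance.
Qed.

Lemma variance_ge0 y : 0 <= variance_fun p y.
Proof. by apply: sumr_ge0 => i _; rewrite mulr_ge0 ?sqr_ge0//; exact: hp.1. Qed.

Lemma energy_star_ge0 y : 0 <= energy_star P p y.
Proof. by apply: sumr_ge0 => i _; exact: sqr_ge0. Qed.

Lemma dissipation_ge0 y : 0 <= dissipation P p y.
Proof.
rewrite addr_ge0 ?energy_star_ge0//.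
by apply: (dirichlet_ge0 y hp.1); exact: transition_matrixX.
Qed.

Lemma variance_box M y : box M y -> variance_fun p y <= 2 * M ^+ 2.
Proof.
move=> /forallP yM; rewrite variance_pairs//.
have [p0 p1] := hp.
have H : \sum_i \sum_j p i * p j * (y i - y j) ^+ 2 <= 4 * M ^+ 2.
  have -> : 4 * M ^+ 2 = \sum_i \sum_j p i * p j * (4 * M ^+ 2).
    under eq_bigr do rewrite -mulr_suml -mulr_sumr p1 mulr1.
    by rewrite -mulr_suml p1 mul1r.
  apply: ler_sum => i _; apply: ler_sum => j _.
  apply: ler_wpM2l; first by rewrite mulr_ge0.
  rewrite -real_normK ?num_real// (_ : 4 * M ^+ 2 = (M + M) ^+ 2); last by ring.
  rewrite lerXn2r ?nnegrE//.
    by rewrite addr_ge0// (le_trans _ (yM i)).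
  by rewrite (le_trans (ler_normB _ _))// lerD.
by lra.
Qed.

Lemma dissipation_le y : dissipation P p y <= n%:R * variance_fun p y.
Proof.
by rewrite dissipationE gerBl sumr_ge0// => k _; exact: variance_ge0.
Qed.

Lemma admissible_variance M : admissible M (variance_fun p) ((1 + n%:R) * (2 * M ^+ 2)).
Proof.
split; first exact: borel_variance.
move=> y yM; rewrite variance_ge0/= (le_trans (variance_box yM))//.
by rewrite ler_peMl ?lerDl// mulr_ge0// sqr_ge0.
Qed.

Lemma admissible_dissipation M :
  admissible M (dissipation P p) ((1 + n%:R) * (2 * M ^+ 2)).
Proof.
split; first exact: borel_dissipation.
move=> y yM; rewrite dissipation_ge0/= (le_trans (dissipation_le y))//.
rewrite (le_trans (ler_wpM2l _ (variance_box yM)))//.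
by rewrite ler_wpM2r ?lerDr// mulr_ge0// sqr_ge0.
Qed.

Lemma spectral_gap : irreducible P -> aperiodic P ->
  exists2 c, 0 < c & forall y, c * variance_fun p y <= dissipation P p y.
Proof.
move=> irr aper.
have [K K0 HK] := poincare (transition_matrixX 2 hP) hp
  (stationaryX 2 (reversible_stationary hP hrev)) (irreducible_square hP irr aper).
exists K^-1; first by rewrite invr_gt0.
move=> y; rewrite mulrC ler_pdivrMr// mulrC (le_trans (HK y))//.
by rewrite ler_wpM2l ?(ltW K0)// lerDl energy_star_ge0.
Qed.

End Functionals.

Section Truncated.
Context {d : measure_display} {T : measurableType d} {R : realType}.
Context {Pr : probability T R} {n : nat} {P : 'M[R]_n} {p : 'I_n -> R}.
Context {N : 'I_n -> R -> {RV Pr >-> nat}} {Y : R -> 'I_n -> {RV Pr >-> R}}.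
Hypotheses (hP : transition_matrix P) (hp : probability_vector p)
  (hrev : reversible P p) (hirr : irreducible P) (haper : aperiodic P).
Hypothesis hY : smoothing_process P N Y.
Local Notation tmean M := (@truncated_mean d T R Pr n Y M).
Local Notation V := (variance_fun p).
Local Notation D := (dissipation P p).

Section Level.
Variable M : R.
Let C : R := (1 + n%:R) * (2 * M ^+ 2).
Let C0 : 0 <= C.
Proof. by rewrite mulr_ge0 ?addr_ge0// mulr_ge0// sqr_ge0. Qed.

Lemma bounded_truncated f t : admissible M f C ->
  bounded_rv (fun w =>
    @start_box d T R Pr n Y M w * boxed M f (@state d T R Pr n Y t w)).
Proof.
by move=> af; apply: bounded_rvM; [exact: bounded_start_box|exact: bounded_boxed C0 af].
Qed.

Lemma truncated_mean_bounds f t : admissible M f C -> 0 <= tmean M t f <= C.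
Proof.
move=> af.
have h w : 0 <= @start_box d T R Pr n Y M w * boxed M f (@state d T R Pr n Y t w) <= C.
  have /andP[s0 s1] := start_box01 (Y := Y) M w.
  have /andP[b0 b1] := boxed01 (@state d T R Pr n Y t w) C0 af.
  by rewrite mulr_ge0//= -[leRHS]mul1r ler_pM.
apply/andP; split; first by apply: mean_ge0 => w; case/andP: (h w).
rewrite -[leRHS](mean_cst Pr); apply: le_mean.
- exact: bounded_truncated.
- exact: bounded_rv_cst.
- by move=> w; case/andP: (h w).
Qed.

(** The drift identity generator_variance, averaged. *)
Lemma truncated_mean_generator t :
  \sum_k tmean M t (fun y => V (update P (Some k) y)) =
  n%:R * tmean M t V - tmean M t D.
Proof.
have aV := admissible_variance hp M; have aD := admissible_dissipation hP hp hrev M.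
have aU k := admissible_update (Some k) hP aV.
apply/eqP; rewrite eq_sym subr_eq eq_sym; apply/eqP.
rewrite -meanZ; last exact: bounded_truncated.
rewrite -mean_sum; last by move=> k; exact: bounded_truncated.
rewrite -meanD; last exact: bounded_truncated; last first.
  by apply: bounded_rv_sum => k; exact: bounded_truncated.
apply: eq_mean => w; rewrite /boxed dissipationE//=.
by rewrite -!mulr_sumr; ring.
Qed.

Let expN_bound (e : R) : 0 <= e -> 0 <= 1 - expR (- (n%:R * e)) <= n%:R * e.
Proof.
move=> e0; have x0 : 0 <= n%:R * e by rewrite mulr_ge0.
have := expR_ge1Dx (- (n%:R * e)); have : expR (- (n%:R * e)) <= 1.
  by rewrite -[leRHS]expR0 ler_expR oppr_le0.
by move=> h1 h2; apply/andP; split; lra.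
Qed.

Let split_option (F : option 'I_n -> R) : \sum_o F o = F None + \sum_k F (Some k).
Proof.
rewrite (bigD1 None)//=; congr (_ + _).
rewrite (reindex_omap Some id)/=; last by case.
by apply: eq_bigl => k; rewrite eqxx.
Qed.

Let K : R := C * (2 * n%:R ^+ 2 + 2 * n%:R).
Let K0 : 0 <= K. Proof. by rewrite mulr_ge0// addr_ge0// mulr_ge0// exprn_ge0. Qed.

(** By the one-step estimate and truncated_mean_generator, the mean at t + e
    is exp (- n e) ((1 + n e) E V - e E D) up to O(e^2), and
    exp (- n e) (1 + n e) = 1 + O(e^2). *)
Lemma variance_step t e : 0 <= t -> 0 < e <= 1 ->
  `|tmean M (t + e) V - tmean M t V + e * tmean M t D| <= K * e ^+ 2.
Proof.
move=> t0 /andP[e0 e1].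
have aV := admissible_variance hp M; have aD := admissible_dissipation hP hp hrev M.
have := truncated_mean_step hP hY C0 aV t0 e0.
have wE : \sum_o weight e o * tmean M t (fun y => V (update P o y)) =
    expR (- (n%:R * e)) * ((1 + n%:R * e) * tmean M t V - e * tmean M t D).
  rewrite split_option /weight mulr1 -mulr_sumr truncated_mean_generator.
  rewrite (_ : tmean M t (fun y => V (update P None y)) = tmean M t V)//.
  by ring.
rewrite wE; set E := expR _.
have /andP[E0 E1] := expN_bound (ltW e0); rewrite -/E in E0 E1.
have /andP[w1 w2] := @sum_weight_bounds R n e (ltW e0).
rewrite sum_weight -/E in w1 w2.
have /andP[v0 v1] := truncated_mean_bounds t aV.
have /andP[d0 d1] := truncated_mean_bounds t aD.
set a := tmean M (t + e) V; set v := tmean M t V in v0 v1 *.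
set g := tmean M t D in d0 d1 *.
move=> H.
have -> : a - v + e * g = (a - E * ((1 + n%:R * e) * v - e * g))
  + ((E * (1 + n%:R * e) - 1) * v + e * ((1 - E) * g)) by ring.
rewrite (le_trans (ler_normD _ _))//.
have A1 : `|(E * (1 + n%:R * e) - 1) * v| <= (n%:R * e) ^+ 2 * C.
  rewrite normrM (ger0_norm v0) ler_pM// ler0_norm; lra.
have A2 : `|e * ((1 - E) * g)| <= e * (n%:R * e * C).
  rewrite normrM (gtr0_norm e0) ler_wpM2l ?(ltW e0)//.
  by rewrite normrM (ger0_norm E0) (ger0_norm d0) ler_pM.
apply: le_trans
  (_ : C * n%:R ^+ 2 * e ^+ 2 + ((n%:R * e) ^+ 2 * C + e * (n%:R * e * C)) <= _).
  by rewrite lerD// (le_trans (ler_normD _ _))// lerD.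
have A3 : 0 <= C * n%:R * e ^+ 2 by rewrite mulr_ge0 ?sqr_ge0// mulr_ge0.
have -> : C * n%:R ^+ 2 * e ^+ 2 + ((n%:R * e) ^+ 2 * C + e * (n%:R * e * C)) =
  K * e ^+ 2 - C * n%:R * e ^+ 2 by rewrite /K; ring.
by lra.
Qed.

(** The letter None has weight 1 - O(e), the other letters have total weight
    O(e), and all the means are bounded by C. *)
Lemma dissipation_step t e : 0 <= t -> 0 < e <= 1 ->
  `|tmean M (t + e) D - tmean M t D| <= K * e.
Proof.
move=> t0 /andP[e0 e1].
have aD := admissible_dissipation hP hp hrev M.
have := truncated_mean_step hP hY C0 aD t0 e0.
rewrite split_option /weight mulr1 -mulr_sumr.
rewrite (_ : tmean M t (fun y => D (update P None y)) = tmean M t D)//.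
set E := expR _.
have /andP[E0 E1] := expN_bound (ltW e0); rewrite -/E in E0 E1.
have Epos : 0 < E by exact: expR_gt0.
have /andP[d0 d1] := truncated_mean_bounds t aD.
set S := \sum_k _.
have S0 : 0 <= S.
  apply: sumr_ge0 => k _.
  by case/andP: (truncated_mean_bounds t (admissible_update (Some k) hP aD)).
have S1 : S <= n%:R * C.
  rewrite -[n in leRHS]card_ord mulr_natl -sumr_const; apply: ler_sum => k _.
  by case/andP: (truncated_mean_bounds t (admissible_update (Some k) hP aD)).
set a := tmean M (t + e) D; set g := tmean M t D in d0 d1 *.
move=> H.
have -> : a - g = (a - (E * g + E * e * S)) + (E * e * S - (1 - E) * g) by ring.
rewrite (le_trans (ler_normD _ _))//.
have A1 : 0 <= E * e * S <= e * (n%:R * C).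
  rewrite !mulr_ge0 ?(ltW e0) ?(ltW Epos)//= ler_pM ?mulr_ge0 ?(ltW e0) ?(ltW Epos)//.
  by rewrite ler_piMl ?(ltW e0)//; lra.
have A2 : 0 <= (1 - E) * g <= n%:R * e * C by rewrite mulr_ge0//= ler_pM.
have A3 : `|E * e * S - (1 - E) * g| <= e * (n%:R * C) + n%:R * e * C.
  rewrite (le_trans (ler_normB _ _))//.
  by move: A1 A2 => /andP[a0 a1] /andP[b0 b1]; rewrite !ger0_norm// lerD.
have A4 : C * n%:R ^+ 2 * e ^+ 2 <= C * n%:R ^+ 2 * e.
  rewrite ler_wpM2l//; first by rewrite mulr_ge0// exprn_ge0.
  by rewrite expr2 ler_piMl// ltW.
have A5 : 0 <= C * n%:R ^+ 2 * e by rewrite mulr_ge0 ?(ltW e0)// mulr_ge0// exprn_ge0.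
have -> : K * e = 2 * (C * n%:R ^+ 2 * e) + (e * (n%:R * C) + n%:R * e * C).
  by rewrite /K; ring.
by lra.
Qed.

Lemma truncated_gap c t : (forall y, c * V y <= D y) ->
  c * tmean M t V <= tmean M t D.
Proof.
move=> gap; have aV := admissible_variance hp M.
have aD := admissible_dissipation hP hp hrev M.
rewrite -meanZ; last exact: bounded_truncated.
apply: le_mean; last 1 first.
- move=> w; rewrite mulrCA ler_wpM2l//.
  by rewrite /boxed mulrCA ler_wpM2l.
- by apply: bounded_rvM; [exact: bounded_rv_cst|exact: bounded_truncated].
- exact: bounded_truncated.
Qed.

Lemma truncated_dissipation_within :
  {within `[0, +oo[, continuous (fun t => tmean M t D)}.
Proof. exact: (continuous_step_rate K0 dissipation_step). Qed.

Lemma integral_truncated_dissipation :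
  (\int[lebesgue_measure]_(t in `[0%R, +oo[) (tmean M t D)%:E
   = (tmean M 0 V)%:E)%E.
Proof.
have [c c0 gap] := spectral_gap hP hp hrev hirr haper.
apply: (integral_step_rate (phi := fun t => tmean M t V) c0 K0).
- by move=> t _; case/andP: (truncated_mean_bounds t (admissible_variance hp M)).
- by move=> t _; exact: truncated_gap.
- exact: variance_step.
- exact: dissipation_step.
Qed.

End Level.

Section Limit.
Variable f : ('I_n -> R) -> R.
Hypotheses (f0 : forall y, 0 <= f y)
  (fC : forall M, exists2 C, 0 <= C & admissible M f C).

Let Z t (k : nat) w : R :=
  @start_box d T R Pr n Y k%:R w * boxed k%:R f (@state d T R Pr n Y t w).

Let box_mono (j k : nat) (y : 'I_n -> R) : (j <= k)%N -> box j%:R y -> box k%:R y.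
Proof.
move=> jk /forallP h; apply/forallP => i; rewrite (le_trans (h i))//.
by rewrite ler_nat.
Qed.

Let Z_ge0 t k w : 0 <= Z t k w.
Proof. by rewrite !mulr_ge0. Qed.

Let Z_mono t w (j k : nat) : (j <= k)%N -> Z t j w <= Z t k w.
Proof.
move=> jk; rewrite /Z /start_box /boxed !mulrA -!natrM ler_wpM2r// ler_nat.
by apply: leq_mul; case: (boolP (box j%:R _)) => // /(box_mono jk) ->.
Qed.

Let bZ t k : bounded_rv (Z t k).
Proof.
have [C C0 af] := fC k%:R.
by apply: bounded_rvM; [exact: bounded_start_box|exact: bounded_boxed C0 af].
Qed.

Let box_large (y : 'I_n -> R) : exists k, box k%:R y.
Proof.
exists (Num.bound (\sum_i `|y i|)); apply/forallP => i.
rewrite ltW// (le_lt_trans _ (archi_boundP _)) ?sumr_ge0//.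
by rewrite (bigD1 i)//= lerDl sumr_ge0.
Qed.

Lemma truncated_mean_mono t (j k : nat) : (j <= k)%N ->
  tmean j%:R t f <= tmean k%:R t f.
Proof. by move=> jk; apply: (le_mean Pr (bZ t j) (bZ t k)) => w; exact: Z_mono. Qed.

Lemma truncated_mean_ge0 (k : nat) t : 0 <= tmean k%:R t f.
Proof. by apply: mean_ge0 => w; exact: (Z_ge0 t k w). Qed.

(** Every path is in the box of level k at times 0 and t once k is large, so
    the truncated integrands increase to f (Y t). *)
Lemma truncated_mean_lim t :
  ('E_Pr[fun w => f (@state d T R Pr n Y t w)] =
   limn (fun k => (tmean k%:R t f)%:E))%E.
Proof.
rewrite unlock.
transitivity (\int[Pr]_w limn (fun k => (Z t k w)%:E))%E.
  apply: eq_integral => w _; apply/esym/cvg_lim => //.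
  apply: cvg_near_cst; have [k0 h0] := box_large (@state d T R Pr n Y 0 w).
  have [k1 h1] := box_large (@state d T R Pr n Y t w).
  near=> k.
  have k0k : (k0 <= k)%N by near: k; exact: nbhs_infty_ge.
  have k1k : (k1 <= k)%N by near: k; exact: nbhs_infty_ge.
  by rewrite /Z /start_box /boxed (box_mono k0k h0) (box_mono k1k h1) !mul1r.
rewrite monotone_convergence//.
- congr (limn _); apply/funext => k.
  by have := EFin_mean Pr (bZ t k); rewrite unlock => <-.
- by move=> k; apply/measurable_EFinP; case: (bZ t k).
- by move=> k w _; rewrite lee_fin.
- by move=> w _ j k jk; rewrite lee_fin Z_mono.
Unshelve. all: by end_near. Qed.

End Limit.

End Truncated.

Theorem corollary4p1 (R : realType) (d : measure_display)
    (T : measurableType d) (Pr : probability T R)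
    (n : nat) (hn : (1 <= n)%N)
    (P : 'M[R]_n) (p : 'I_n -> R)
    (hP : transition_matrix P) (hirr : irreducible P) (haper : aperiodic P)
    (hp : probability_vector p) (hrev : reversible P p)
    (N : 'I_n -> R -> {RV Pr >-> nat}) (Y : R -> 'I_n -> {RV Pr >-> R})
    (hY : smoothing_process P N Y)
    (hY0 : {ae Pr, forall w, forall i, 0 <= Y 0 i w}) :
  (\int[lebesgue_measure]_(t in `[0%R, +oo[)
     'E_Pr[fun w => (energy2 P p (fun k => Y t k w)
                     + energy_star P p (fun k => Y t k w))%R]
   = 'E_Pr[fun w => variance_fun p (fun k => Y 0%R k w)])%E.
Proof.
pose V := variance_fun p; pose D := dissipation P p.
pose tm (k : nat) := @truncated_mean d T R Pr n Y k%:R.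
have C0 (M : R) : 0 <= (1 + n%:R) * (2 * M ^+ 2).
  by rewrite mulr_ge0 ?addr_ge0// mulr_ge0// sqr_ge0.
have aV (M : R) : exists2 C, 0 <= C & admissible M V C.
  by exists ((1 + n%:R) * (2 * M ^+ 2)) => //; exact: admissible_variance.
have aD (M : R) : exists2 C, 0 <= C & admissible M D C.
  by exists ((1 + n%:R) * (2 * M ^+ 2)) => //; exact: admissible_dissipation.
have V0 y : 0 <= V y by exact: variance_ge0.
have D0 y : 0 <= D y by exact: dissipation_ge0.
transitivity
  (\int[lebesgue_measure]_(t in `[0%R, +oo[) limn (fun k => (tm k t D)%:E))%E.
  by apply: eq_integral => t _; exact: (truncated_mean_lim D0 aD).
rewrite monotone_convergence//; last 3 first.
- move=> k; apply/measurable_EFinP; apply: subspace_continuous_measurable_fun => //.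
  exact: (truncated_dissipation_within hP hp hrev hY).
- by move=> k t _; rewrite lee_fin; exact: truncated_mean_ge0.
- by move=> t _ j k jk; rewrite lee_fin; exact: truncated_mean_mono.
rewrite (truncated_mean_lim V0 aV 0).
congr (limn _); apply/funext => k.
exact: (integral_truncated_dissipation hP hp hrev hirr haper hY).
Qed.
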